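(* Let $K$ be an algebraically closed field of characteristic $p>0$, let $q\ge 3$ be a power of $p$, let $n\ge 1$, and let $F_n(q+1)\subset\mathbb{P}^{n+1}$ be the Fermat hypersurface of degree $q+1$ over $K$, defined by $X_0^{q+1}+X_1^{q+1}+\dots+X_{n+1}^{q+1}=0$. Then a point $P\in\mathbb{P}^{n+1}$ is Galois for $F_n(q+1)$ if and only if $P$ is $\mathbb{F}_{q^2}$-rational.
   Context: For a smooth hypersurface $X\subset\mathbb{P}^{n+1}$, a point $P\in\mathbb{P}^{n+1}$ is Galois for $X$ if the function field extension $K(X)/K(\mathbb{P}^n)$ induced by the projection $\pi_P:X\dashrightarrow\mathbb{P}^n$ from $P$ is Galois. $P$ is $\mathbb{F}_{q^2}$-rational if it has homogeneous coordinates in $\mathbb{F}_{q^2}$. *)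

(* Defs.v *)
From HB Require Import structures.
From mathcomp Require Import all_boot all_order all_algebra all_field.
From mathcomp Require Import boolp mpoly ring.

Set Implicit Arguments.
Unset Strict Implicit.
Unset Printing Implicit Defensive.

Import GRing.Theory.
Local Open Scope ring_scope.

Local Notation "x %:F" := (FracField.tofrac x).

Definition principal_ideal (R : comNzRingType) (f : R) : {pred R} :=
  fun g => `[< exists h, g = h * f >].

(* An integral hypersurface of P^N, given by a homogeneous equation in the
   N + 1 homogeneous coordinates that generates a prime ideal. A smooth
   hypersurface of dimension at least 1 is integral. *)
Record hypersurface (K : fieldType) (N : nat) := Hypersurface {
  hs_eq : {mpoly K[N.+1]};
  hs_deg : nat;
  hs_homog : hs_eq \is hs_deg.-homog;
  hs_neq0 : hs_eq != 0;
  hs_proper : 1 \notin principal_ideal hs_eq;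
  hs_prime : prime_idealr_closed (principal_ideal hs_eq)
}.

Section CoordinateRing.
Variables (K : fieldType) (N : nat) (X : hypersurface K N).

Definition hs_ideal : {pred {mpoly K[N.+1]}} := principal_ideal (hs_eq X).

Lemma hs_ideal_closed : idealr_closed hs_ideal.
Proof.
split; first by apply/asboolP; exists 0; rewrite mul0r.
  exact: hs_proper.
move=> a u v /asboolP[g ->] /asboolP[h ->]; apply/asboolP.
by exists (a * g + h); rewrite mulrDl mulrA.
Qed.

HB.instance Definition _ := isIdealr.Build _ hs_ideal hs_ideal_closed.
HB.instance Definition _ :=
  isPrimeIdealrClosed.Build _ hs_ideal (@hs_prime _ _ X).

Definition coord_ring : Type := {ideal_quot hs_ideal}.

HB.instance Definition _ := GRing.ComNzRing.on coord_ring.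

(* MathComp makes a quotient by a prime ideal a commutative ring satisfying the
   integrality axiom, but chooses no inverse; units are decided classically. *)
Definition coord_unit : pred coord_ring := fun x => `[< exists y, y * x = 1 >].
Definition coord_inv (x : coord_ring) : coord_ring :=
  if pselect (exists y, y * x = 1) is left e then projT1 (cid e) else x.

Lemma coord_mulVx : {in coord_unit, left_inverse 1 coord_inv *%R}.
Proof.
move=> x /asboolP ux; rewrite /coord_inv; case: pselect => // e.
exact: projT2 (cid e).
Qed.

Lemma coord_unitPl x y : y * x = 1 -> coord_unit x.
Proof. by move=> yx; apply/asboolP; exists y. Qed.

Lemma coord_inv_out : {in [predC coord_unit], coord_inv =1 id}.
Proof.
move=> x /negP ux; rewrite /coord_inv; case: pselect => // e.
by case: ux; apply/asboolP.
Qed.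

HB.instance Definition _ := GRing.ComNzRing_hasMulInverse.Build coord_ring
  coord_mulVx coord_unitPl coord_inv_out.

HB.instance Definition _ := GRing.ComUnitRing_isIntegral.Build coord_ring
  (@Quotient.rquot_IdomainAxiom _ hs_ideal).

Definition coord_proj : {mpoly K[N.+1]} -> coord_ring := \pi_{ideal_quot hs_ideal}%qT.

HB.instance Definition _ := GRing.RMorphism.on coord_proj.

Lemma coord_proj_eq0 g : (coord_proj g == 0) = (g \in hs_ideal).
Proof. by rewrite -(rmorph0 coord_proj) /coord_proj -Quotient.idealrBE subr0. Qed.

End CoordinateRing.

Section SubField.
Variables (F : fieldType) (S : divringClosed F).

Record subfield_of := SubFieldOf {
  subfield_val :> F;
  _ : subfield_val \in S
}.

HB.instance Definition _ := [isSub for subfield_val].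
HB.instance Definition _ := [Choice of subfield_of by <:].
HB.instance Definition _ := [SubChoice_isSubIntegralDomain of subfield_of by <:].
HB.instance Definition _ := [SubIntegralDomain_isSubField of subfield_of by <:].

End SubField.

Lemma subf_frac (F : fieldType) (a b c d : F) : b != 0 -> d != 0 ->
  a / b - c / d = (a * d - b * c) / (b * d).
Proof. by move=> b0 d0; field; rewrite b0 d0. Qed.

Lemma divf_frac (F : fieldType) (a b c d : F) : b != 0 -> d != 0 -> c != 0 ->
  a / b / (c / d) = (a * d) / (b * c).
Proof. by move=> b0 d0 c0; field; rewrite b0 c0 d0. Qed.

Section DegreeZero.
Variables (K : fieldType) (m : nat) (S : idomainType).
Variable phi : {rmorphism {mpoly K[m]} -> S}.

Definition frac_of (g h : {mpoly K[m]}) : {fraction S} :=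
  (phi g)%:F / (phi h)%:F.

(* The elements of the fraction field of the homogeneous coordinate ring S, a
   quotient of a polynomial ring by phi, that are quotients of two forms of the
   same degree. *)
Definition degree0 : {pred {fraction S}} := fun x =>
  `[< exists d g h, [/\ g \is d.-homog, h \is d.-homog, phi h != 0
                        & x = frac_of g h] >].

Lemma degree0_divring_closed : divring_closed degree0.
Proof.
have F0 h : phi h != 0 -> (phi h)%:F != 0 by rewrite tofrac_eq0.
split.
- apply/asboolP; exists 0%N, 1, 1.
  by rewrite /frac_of rmorph1 oner_neq0 tofrac1 divr1 dhomog1.
- move=> x y /asboolP[d [g [h [hg hh h0 ->]]]] /asboolP[d' [g' [h' [hg' hh' h0' ->]]]].
  apply/asboolP; exists (d + d')%N, (g * h' - h * g'), (h * h').
  rewrite rpredB ?dhomogM // rmorphM mulf_neq0 //; split=> //.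
  rewrite /frac_of rmorphB !rmorphM /= tofracB !tofracM.
  exact: subf_frac (F0 _ h0) (F0 _ h0').
- move=> x y /asboolP[d [g [h [hg hh h0 ->]]]] /asboolP[d' [g' [h' [hg' hh' h0' ->]]]].
  have [g0|g0] := eqVneq (phi g') 0.
    apply/asboolP; exists 0%N, 0, 1.
    by rewrite /frac_of g0 !(rmorph0, rmorph1) oner_neq0 dhomog1 rpred0 !mul0r invr0 mulr0.
  apply/asboolP; exists (d + d')%N, (g * h'), (h * g').
  rewrite !dhomogM // rmorphM mulf_neq0 //; split=> //.
  rewrite /frac_of !rmorphM.
  exact: divf_frac (F0 _ h0) (F0 _ h0') (F0 _ g0).
Qed.

HB.instance Definition _ :=
  GRing.isDivringClosed.Build _ degree0 degree0_divring_closed.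

End DegreeZero.


Section FunctionFields.
Variable K : fieldType.

Definition proj_space_function_field (N : nat) : fieldType :=
  subfield_of (degree0 (@idfun {mpoly K[N.+1]})).

Definition function_field (N : nat) (X : hypersurface K N) : fieldType :=
  subfield_of (degree0 (coord_proj X)).

End FunctionFields.

Section Galois.
Variables (F L : fieldType) (iota : {rmorphism F -> L}).

Definition algebraic_ext : Prop := forall x : L, algebraicOver iota x.

Definition normal_ext : Prop :=
  forall f : {poly F}, irreducible_poly f ->
  (exists x, root (map_poly iota f) x) ->
  exists rs : seq L, map_poly iota f %= \prod_(r <- rs) ('X - r%:P).

Definition separable_ext : Prop :=
  forall f : {poly F}, irreducible_poly f ->
  (exists x, root (map_poly iota f) x) -> separable_poly f.

(* The library's galois is restricted to subfields of a splitting field that is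
   finite-dimensional over a base field. *)
Definition galois_ext : Prop := [/\ algebraic_ext, normal_ext & separable_ext].

End Galois.

Section Projection.
Variables (K : fieldType) (n : nat).

(* The rational map P^(n+1) --> P^n sending a row vector x of homogeneous
   coordinates to x *m A is the projection from P, for some choice of
   homogeneous coordinates on the target: its centre is the kernel of A, which
   is the line spanned by P as soon as P is non-zero. *)
Definition projection_from (P : 'rV[K]_n.+2) (A : 'M[K]_(n.+2, n.+1)) : Prop :=
  P *m A = 0 /\ \rank A = n.+1.

Definition linear_forms (A : 'M[K]_(n.+2, n.+1)) :
    n.+1.-tuple {mpoly K[n.+2]} :=
  [tuple \sum_(i < n.+2) A i j *: 'X_i | j < n.+1].

(* iota maps g / h to g(l_0, ..., l_n) / h(l_0, ..., l_n), where l_0, ..., l_n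
   are the linear forms defining the projection. As iota is injective, the last
   denominator is non-zero on X: taking g = h, the value cannot be 0. *)
Definition pullback (X : hypersurface K n.+1) (A : 'M[K]_(n.+2, n.+1))
    (iota : {rmorphism proj_space_function_field K n -> function_field X}) :
    Prop :=
  forall (d : nat) (g h : {mpoly K[n.+1]})
         (x : proj_space_function_field K n),
    g \is d.-homog -> h \is d.-homog -> h != 0 ->
    subfield_val x = frac_of idfun g h ->
    subfield_val (iota x) = frac_of (coord_proj X)
      (g \mPo linear_forms A) (h \mPo linear_forms A).

(* Two choices of A differ by a linear automorphism of the target, so "exists A"
   could equivalently be "for all A". *)
Definition galois_point (X : hypersurface K n.+1) (P : 'rV[K]_n.+2) : Prop :=
  exists2 A, projection_from P A &
  exists2 iota : {rmorphism proj_space_function_field K n -> function_field X},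
    pullback A iota & galois_ext iota.

(* When K is algebraically closed of characteristic p and m is a positive power
   of p, the solutions of c ^+ m = c are the subfield of K with m elements. *)
Definition rational_point (m : nat) (P : 'rV[K]_n.+2) : Prop :=
  exists2 c : K, c != 0 & forall i, (c * P 0 i) ^+ m = c * P 0 i.

End Projection.

(* Irreducibility of X^d + a by norms: the constant term c of a factor of degree
   e satisfies c^d = (-a)^e up to sign. *)
Lemma irredp_XnaddC (E : fieldType) (d : nat) (a : E) : (0 < d)%N ->
  (forall (e : nat) (c : E), c ^+ d = (- a) ^+ e -> (d %| e)%N) ->
  irreducible_poly ('X^d + a%:P).
Proof.
move=> d_gt0 Hd; have szp : size ('X^d + a%:P) = d.+1 by exact: size_XnaddC.
split=> [|q szq dvdq]; first by rewrite szp ltnS.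
have q0 : q != 0.
  by apply: contraTneq dvdq => ->; rewrite dvd0p -size_poly_eq0 szp.
wlog qm : q szq dvdq q0 / q \is monic.
  move=> /(_ ((lead_coef q)^-1 *: q)); have l0 : (lead_coef q)^-1 != 0.
    by rewrite invr_eq0 lead_coef_eq0.
  rewrite size_scale // dvdpZl // scaler_eq0 (negPf l0) (negPf q0) monicE.
  rewrite lead_coefZ mulVf ?lead_coef_eq0 // eqxx.
  by move=> /(_ szq dvdq isT isT); apply: eqp_trans; rewrite eqp_sym eqp_scale.
case szq' : (size q) szq => [|[|e]] // _; first by move/eqP: szq'; rewrite size_poly_eq0 (negPf q0).
have : (d %| e.+1)%N.
  have szC : (size q).-1 = e.+1 by rewrite szq'.
  have [M chM] : exists M : 'M[E]_e.+1, char_poly M = q.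
    exists (castmx (szC, szC) (companionmx q)).
    by rewrite -[RHS](companionmxK qm); case: _ / szC.
  have pM : horner_mx M ('X^d + a%:P) = 0.
    by case/dvdpP: dvdq => r ->; rewrite rmorphM /= -chM Cayley_Hamilton mulr0.
  move: pM; rewrite rmorphD rmorphXn /= horner_mx_X horner_mx_C => /eqP.
  rewrite addr_eq0 => /eqP /(congr1 determinant) dM.
  apply: (Hd _ (\det M)); rewrite -raddfN det_scalar in dM; rewrite -dM.
  by elim: (d) => [|k IH]; rewrite ?det1 // !exprS IH -det_mulmx.
move/dvdn_leq => /(_ isT) le_de.
rewrite -dvdp_size_eqp // szq' szp eqSS eqn_leq le_de andbT.
by have := dvdp_leq _ dvdq; rewrite szq' szp ltnS; apply; rewrite -size_poly_eq0 szp.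
Qed.

Lemma exists_irredp_factor (k : fieldType) (p : {poly k}) : (1 < size p)%N ->
  exists2 q, irreducible_poly q & q %| p.
Proof.
elim/ltn_ind: {p}(size p) {-2}p (erefl (size p)) => s IH p szp s_gt1.
have [[q [q1 dq nq]]|nex] := pselect (exists q : {poly k}, [/\ size q != 1, q %| p & ~~ (q %= p)]).
  have p0 : p != 0 by rewrite -size_poly_gt0 (ltn_trans _ s_gt1).
  have q0 : q != 0 by apply: contraTneq dq => ->; rewrite dvd0p.
  have sq : (size q < s)%N.
    by rewrite -szp ltn_neqAle dvdp_leq // dvdp_size_eqp // nq.
  have sq1 : (1 < size q)%N by rewrite ltn_neqAle eq_sym q1 size_poly_gt0.
  have [r ir dr] := IH _ sq q erefl sq1.
  by exists r => //; apply: dvdp_trans dq.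
exists p => //; split=> [|q q1 dq] //.
by apply: contrapT => /negP nq; apply: nex; exists q.
Qed.

Lemma poly_val_uniq (k : fieldType) (w u v : {poly k}) s t : w != 0 ->
  ~~ (w %| u) -> ~~ (w %| v) -> w ^+ s * u = w ^+ t * v -> s = t.
Proof.
move=> w0; wlog le_st : s t u v / (s <= t)%N.
  move=> H nu nv e; case/orP: (leq_total s t) => l; first exact: (H s t u v).
  by apply/esym/(H t s v u).
move=> nu nv; rewrite -(subnKC le_st) exprD -mulrA => /(mulfI (expf_neq0 s w0)) e.
case E : (t - s)%N e nu => [|j] ->; first by rewrite addn0.
by rewrite exprS -mulrA dvdp_mulr.
Qed.

Lemma poly_val_ex (k : fieldType) (w u : {poly k}) : (1 < size w)%N -> u != 0 ->
  exists s v, u = w ^+ s * v /\ ~~ (w %| v).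
Proof.
move=> szw; elim/ltn_ind: {u}(size u) {-2}u (erefl (size u)) => n IH u szu u0.
have w0 : w != 0 by rewrite -size_poly_gt0 (ltn_trans _ szw).
have [/dvdpP[v uv]|] := boolP (w %| u); last by exists 0%N, u; rewrite mul1r.
have v0 : v != 0 by apply: contraNneq u0 => v0; rewrite uv v0 mul0r.
have : (size v < n)%N.
  rewrite -szu uv size_mul //; case: (size w) szw => [|[|j]] // _.
  by rewrite !addnS /= ltnS leq_addr.
move=> lt; case: (IH _ lt v erefl v0) => s [v' [e nv]].
by exists s.+1, v'; rewrite uv e exprSr mulrAC.
Qed.

Lemma fracP (R : idomainType) (x : {fraction R}) :
  exists u v : R, v != 0 /\ x * FracField.tofrac v = FracField.tofrac u.
Proof.
rewrite -[x]reprK; set r := repr x.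
exists (\n_r), (\d_r); split; first exact: denom_ratioP.
unlock FracField.tofrac; rewrite -[LHS]FracField.pi_mul.
apply/eqP; rewrite FracField.equivf_def /FracField.mulf /= !numden_Ratio ?oner_neq0 //.
- by rewrite !mulr1 mulrC.
- by rewrite mulr1 denom_ratioP.
- by rewrite mulr1 denom_ratioP.
Qed.

(* An irreducible factor of X^d + b occurs with multiplicity 1, which is
   incompatible with (X^d + b)^e being a d-th power unless d divides e. *)
Lemma frac_pow_dvd (k : fieldType) (d : nat) (b : k) : d%:R != 0 :> k -> b != 0 ->
  forall (e : nat) (c : {fraction {poly k}}),
  c ^+ d = (- FracField.tofrac ('X^d + b%:P)) ^+ e -> (d %| e)%N.
Proof.
move=> d0 b0 e c; have d_gt0 : (0 < d)%N by case: (d) d0; rewrite ?eqxx.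
set al := 'X^d + b%:P => Hc.
have sz_al : size al = d.+1 by exact: size_XnaddC.
have [w irw dw] : exists2 q, irreducible_poly q & q %| al.
  by apply: exists_irredp_factor; rewrite sz_al ltnS.
have [be al_e] := dvdpP _ _ dw.
have szw := irw.1; have w0 := irredp_neq0 irw.
have prw g h : ~~ (w %| g) -> ~~ (w %| h) -> ~~ (w %| g * h).
  move=> ng; apply: contra; rewrite Gauss_dvdpr //.
  by rewrite irreducible_poly_coprime.
have prwX g n : ~~ (w %| g) -> ~~ (w %| g ^+ n).
  move=> ng; elim: n => [|n IH]; last by rewrite exprS prw.
  by rewrite dvdp1 neq_ltn szw orbT.
have nbe : ~~ (w %| be).
  apply/negP => /dvdpP[ga be_e].
  have dw' : w %| al^`().
    by rewrite al_e be_e derivM dvdp_addr; [rewrite dvdp_mulr ?dvdp_mulIr | rewrite dvdp_mulIr].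
  have : w %| 'X^(d.-1).
    move: dw'; rewrite /al derivD derivC addr0 derivXn -scaler_nat.
    by rewrite dvdpZr.
  move=> dX; have : w %| 'X^d by rewrite -(prednK d_gt0) exprS dvdp_mull.
  move: dw; rewrite /al addrC => dw1 dw2; move: dw1; rewrite dvdp_addl //.
  by move/dvdp_leq; rewrite polyC_eq0 b0 size_polyC b0 => /(_ isT); rewrite leqNgt szw.
have [u [v [v0 cv]]] := fracP c.
have uv : u ^+ d = (- al) ^+ e * v ^+ d.
  apply/eqP; rewrite -tofrac_eq tofracXn -cv exprMn Hc.
  by rewrite tofracM !tofracXn tofracN.
have al0 : al != 0 by rewrite -size_poly_gt0 sz_al.
have u0 : u != 0.
  apply: contraTneq (mulf_neq0 (expf_neq0 e (_ : - al != 0)) (expf_neq0 d v0)).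
  - by move=> u0; rewrite -uv u0 expr0n eqn0Ngt d_gt0 eqxx.
  - by rewrite oppr_eq0.
have [i [u' [ue nu]]] := poly_val_ex szw u0.
have [j [v' [ve nv]]] := poly_val_ex szw v0.
have : (i * d = e + j * d)%N.
  apply: (@poly_val_uniq _ w (u' ^+ d) ((- be) ^+ e * v' ^+ d)) => //.
  - exact: prwX.
  - by apply: prw; apply: prwX; rewrite ?dvdpNr.
  - move: uv; rewrite ue ve al_e -mulNr !exprMn -!exprM exprD => ->.
    by move: (w ^+ _) (w ^+ _) => A B; ring.
by move=> H; rewrite -(dvdn_addl _ (dvdn_mull j (dvdnn d))) -H dvdn_mull.
Qed.

Definition fermat_poly (K : fieldType) (m d : nat) : {mpoly K[m]} :=
  \sum_(i < m) 'X_i ^+ d.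

Section Muni.
Variables (n : nat) (K : fieldType).

Lemma muniX (i : 'I_n.+1) : muni ('X_i : {mpoly K[n.+1]}) =
  if unlift ord_max i is Some j then ('X_j)%:P else 'X.
Proof.
rewrite muniE msuppX big_seq1 mcoeffX eqxx scale1r.
case: unliftP => [j|] ->.
  rewrite mnm1E eq_sym (negPf (neq_lift _ _)) expr0 alg_polyC.
  congr (_ %:P); congr ('X_[_]); apply/mnmP => l; rewrite !mnmE.
  by rewrite -!val_eqE /= /bump leqNgt ltn_ord.
rewrite mnmE eqxx expr1 [X in 'X_[X]](_ : _ = 0%MM) ?mpolyX0 ?scale1r //.
by apply/mnmP => l; rewrite !mnmE -val_eqE /= gtn_eqF.
Qed.

Definition unmuni (p : {poly {mpoly K[n]}}) : {mpoly K[n.+1]} :=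
  (map_poly (@mwiden n K) p).['X_ord_max].

Lemma muniK : cancel (@muni n K) unmuni.
Proof.
have unM : {morph unmuni : p q / p * q}.
  by move=> p q; rewrite /unmuni rmorphM hornerM.
have un1 : unmuni 1 = 1 by rewrite /unmuni rmorph1 hornerE.
have unD : {morph unmuni : p q / p + q}.
  by move=> p q; rewrite /unmuni rmorphD hornerD.
have un0 : unmuni 0 = 0 by rewrite /unmuni rmorph0 hornerE.
move=> p; rewrite [in RHS](mpolyE p) [in LHS](mpolyE p).
rewrite rmorph_sum (big_morph _ unD un0); apply: eq_bigr => m _.
rewrite -mul_mpolyC rmorphM unM /=; congr (_ * _).
  by rewrite muniC /unmuni map_polyC hornerC /= mwidenC.
rewrite mpolyXE_id rmorph_prod (big_morph _ unM un1); apply: eq_bigr => i _.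
rewrite rmorphXn (_ : unmuni (_ ^+ _) = unmuni (muni 'X_i) ^+ m i); last first.
  by elim: (m i) => [|k IH]; rewrite ?expr0 // !exprS unM IH.
congr (_ ^+ _); rewrite muniX /unmuni; case: unliftP => [j|] ->.
  rewrite map_polyC hornerC /= mwidenX mnmwiden1; congr ('X_[U_(_)]).
  by apply: val_inj; rewrite /= /bump leqNgt ltn_ord.
by rewrite map_polyX hornerX.
Qed.

Lemma muni_fermat d :
  muni (fermat_poly K n.+1 d) = 'X^d + (fermat_poly K n d)%:P.
Proof.
rewrite /fermat_poly rmorph_sum big_ord_recr /= addrC; congr (_ + _).
  by rewrite rmorphXn /= muniX unlift_none.
rewrite rmorph_sum /=; apply: eq_bigr => i _; rewrite !rmorphXn /= muniX.
by rewrite (_ : widen_ord _ i = lift ord_max i) ?liftK //; apply/val_inj; rewrite /= /bump leqNgt ltn_ord.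
Qed.

End Muni.

Lemma fermat_poly_neq0 (K : fieldType) (m d : nat) : (0 < m)%N -> (0 < d)%N ->
  fermat_poly K m d != 0.
Proof.
case: m => // m _ d0; apply/eqP => /(congr1 (@muni m K)).
rewrite muni_fermat rmorph0 => /(congr1 (fun p : {poly _} => size p)).
by rewrite size_XnaddC // size_poly0.
Qed.

Lemma map_poly_injR (R S : nzRingType) (f : {rmorphism R -> S}) :
  injective f -> injective (map_poly f).
Proof.
move=> fI p q /polyP H; apply/polyP => i; apply: fI.
by have := H i; rewrite !coef_map.
Qed.

Lemma monic_dvdp_map (R : comNzRingType) (E : fieldType)
    (emb : {rmorphism R -> E}) (f g : {poly R}) :
  injective emb -> f \is monic -> map_poly emb f %| map_poly emb g ->
  exists q, g = q * f.
Proof.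
move=> embI mf dv.
pose q := Pdiv.Ring.rdivp g f; pose r := Pdiv.Ring.rmodp g f.
have e : g = q * f + r by exact: Pdiv.RingMonic.rdivp_eq.
have sr : (size r < size f)%N by rewrite Pdiv.Ring.ltn_rmodpN0 // monic_neq0.
exists q; suff r0 : r = 0 by rewrite {1}e r0 addr0.
have szI p : size (map_poly emb p) = size p.
  by rewrite size_map_inj_poly // rmorph0.
move: dv; rewrite e rmorphD rmorphM /= dvdp_addr ?dvdp_mulIr //.
move/dvdp_leq; rewrite -size_poly_gt0 !szI size_poly_gt0 => H.
by apply/eqP; apply: contraTT sr => r0; rewrite -leqNgt H.
Qed.

Section FermatPrime.
Variables (K : fieldType) (n d : nat).
Hypothesis d_neq0 : d%:R != 0 :> K.

Local Notation R1 := {mpoly K[n.+1]}.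
Local Notation R2 := {mpoly K[n.+2]}.
Local Notation k1 := {fraction R1}.
Local Notation E2 := {fraction {poly k1}}.

Definition fermat_emb (p : R2) : E2 :=
  FracField.tofrac (map_poly (@FracField.tofrac R1) (muni p)).

HB.instance Definition _ := GRing.RMorphism.copy fermat_emb
  (@FracField.tofrac {poly k1} \o map_poly (@FracField.tofrac R1) \o @muni n.+1 K).

Lemma fermat_emb_inj : injective fermat_emb.
Proof.
move=> p q /eqP; rewrite /fermat_emb tofrac_eq => /eqP H.
apply: (can_inj (@muniK n.+1 K)).
apply: (map_poly_injR _ H).
by move=> a b /eqP; rewrite tofrac_eq => /eqP.
Qed.

Lemma fermat_prime : prime_idealr_closed (principal_ideal (fermat_poly K n.+3 d)).
Proof.
have d_gt0 : (0 < d)%N by case: (d) d_neq0; rewrite ?eqxx.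
pose Th p := map_poly fermat_emb (@muni n.+2 K p).
have ThM p q : Th (p * q) = Th p * Th q by rewrite /Th !rmorphM.
set f := fermat_poly K n.+3 d.
have [b b0 Thf] : exists2 b : k1, b != 0 &
    Th f = 'X^d + (FracField.tofrac ('X^d + b%:P))%:P.
  exists (FracField.tofrac (fermat_poly K n.+1 d)).
    by rewrite tofrac_eq0 fermat_poly_neq0.
  rewrite /Th muni_fermat rmorphD /= map_polyXn map_polyC /=.
  by rewrite /fermat_emb muni_fermat rmorphD /= map_polyXn map_polyC.
have dk : d%:R != 0 :> k1.
  rewrite -(rmorph_nat (@FracField.tofrac R1)) tofrac_eq0.
  by rewrite -(rmorph_nat (@mpolyC n.+1 K)) mpolyC_eq0.
have irr : irreducible_poly (Th f).
  by rewrite Thf; apply: irredp_XnaddC => //; apply: frac_pow_dvd.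
have mf : muni f \is monic by rewrite muni_fermat monicE lead_coefDl ?lead_coefXn // size_polyXn (leq_ltn_trans (size_polyC_leq1 _)).
have back g : Th f %| Th g -> g \in principal_ideal f.
  move=> dv; apply/asboolP.
  have [q e] := monic_dvdp_map fermat_emb_inj mf dv.
  exists (unmuni q); rewrite -[LHS]muniK e -[in RHS](muniK f).
  by rewrite /unmuni rmorphM hornerM.
move=> u v /asboolP[h uv].
have : Th f %| Th u * Th v by rewrite -ThM uv ThM dvdp_mulIr.
have [du|ndu] := boolP (Th f %| Th u); first by rewrite (back _ du).
rewrite Gauss_dvdpr ?irreducible_poly_coprime // => /back ->.
by rewrite orbT.
Qed.

End FermatPrime.

Lemma fermat_poly_homog (K : fieldType) (m d : nat) :
  fermat_poly K m d \is d.-homog.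
Proof.
apply: rpred_sum => i _; 
have hX : ('X_i : {mpoly K[m]}) \is 1.-homog by rewrite dhomogX /= mdeg1.
by have := dhomogMn d hX; rewrite mul1n.
Qed.

Section FermatHypersurface.
Variables (K : fieldType) (n d : nat).
Hypotheses (n_gt0 : (0 < n)%N) (d_neq0 : d%:R != 0 :> K).

Let d_gt0 : (0 < d)%N.
Proof. by case: (d) d_neq0; rewrite ?eqxx. Qed.

Lemma fermat_poly_proper : 1 \notin principal_ideal (fermat_poly K n.+2 d).
Proof.
apply/negP => /asboolP[h /(congr1 (meval (fun _ => 0)))].
rewrite rmorph1 rmorphM /= [X in _ * X](_ : _ = 0) ?mulr0.
  by move/eqP; rewrite oner_eq0.
rewrite rmorph_sum big1 //= => i _.
by rewrite rmorphXn /= mevalXU expr0n eqn0Ngt d_gt0.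
Qed.

Lemma fermat_poly_prime :
  prime_idealr_closed (principal_ideal (fermat_poly K n.+2 d)).
Proof. by case: n n_gt0 => // k _; apply: fermat_prime. Qed.

Definition fermat_hypersurface : hypersurface K n.+1 :=
  Hypersurface (fermat_poly_homog K n.+2 d)
    (fermat_poly_neq0 K (ltn0Sn n.+1) d_gt0)
    fermat_poly_proper fermat_poly_prime.

End FermatHypersurface.

Lemma natrS_neq0 (K : fieldType) (p e q : nat) : p \in [pchar K] ->
  q = (p ^ e)%N -> (3 <= q)%N -> q.+1%:R != 0 :> K.
Proof.
move=> pK -> ; case: e => // e _.
by rewrite -addn1 natrD expnS natrM (pcharf0 pK) mul0r add0r oner_neq0.
Qed.

(* Main.v *)
(** Write F for the Fermat form and q = p^e. Since x |-> x^q is additive,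
    F(x + d P) = F(x) + d l^q + d^q b + d^(q+1) F(P), where b is the linear form
    with coefficients P_i^q and l the one whose coefficients are the q-th roots
    of the P_i. So the conjugates of a generic point x of X on the line through
    P are the x + d P with d a root of d l^q + d^q b + d^(q+1) F(P), a
    polynomial of degree q or q + 1 that is irreducible up to the change of
    coordinates x |-> x + d P.

    P is rational over the field with q^2 elements if and only if b and l are
    proportional. In that case P may be rescaled so that b = l, and the roots
    are d = m b with m in K, all of them in the function field of X.

    Conversely, suppose that the extension is Galois and b, l are independent.
    If F(P) = 0, a nonzero root gives g = d / l with g^(q-1) = - l / b; taking
    norms down to the function field of P^n, the element (l / b)^q is a
    (q-1)-th power, which is impossible for q > 2. If F(P) <> 0, two nonzero
    roots give an element z of the function field of X such that
    (z^q - z)^(q-1) is a constant times l / b, so that z has degree q (q - 1)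
    over any purely transcendental field K(b, l, ...). But X is an extension of
    degree at most q + 1 of such a field, by projecting it from a point where b
    and l vanish, and q + 1 < q (q - 1). *)

Require Import Defs.
From HB Require Import structures.
From mathcomp Require Import all_boot all_order all_fingroup all_algebra all_field.
From mathcomp Require Import boolp mpoly ring zify.

Set Implicit Arguments.
Unset Strict Implicit.
Unset Printing Implicit Defensive.

Import GRing.Theory.
Local Open Scope ring_scope.

Local Notation "x %:F" := (FracField.tofrac x).

(** * Simple field extensions *)

Section FracLift.
Variables (R : idomainType) (M : fieldType) (phi : {rmorphism R -> M}).
Hypothesis phiI : injective phi.

(** Numerator and denominator are picked by choice. The injectivity of [phi] is part of the term, so
    that the morphism structure resting on it can be attached. *)
Definition frac_lift of injective phi := fun x : {fraction R} =>
  let u := cid (fracP x) in let v := cid (projT2 u) in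
  phi (projT1 u) / phi (projT1 v).

Lemma frac_liftE x u v : v != 0 -> x * v%:F = u%:F ->
  frac_lift phiI x = phi u / phi v.
Proof.
move=> v0 xv; rewrite /frac_lift; case: cid => u' /= [v' e] /=.
case: cid => {e}v' /= [v'0 xv'].
have p0 w : w != 0 -> phi w != 0.
  by apply: contraNneq => w0; apply/eqP/phiI; rewrite rmorph0.
apply/eqP; rewrite eqr_div ?p0 // -!rmorphM; apply/eqP; congr (phi _).
by apply/eqP; rewrite -tofrac_eq !tofracM -xv -xv' mulrAC.
Qed.

Lemma frac_lift_tofrac x : frac_lift phiI x%:F = phi x.
Proof.
by rewrite (@frac_liftE _ x 1) ?oner_neq0 ?tofrac1 ?mulr1 // rmorph1 divr1.
Qed.

Lemma frac_lift_zmod : zmod_morphism (frac_lift phiI).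
Proof.
move=> x y; have [u [v [v0 xv]]] := fracP x; have [u' [v' [v'0 yv]]] := fracP y.
have p0 w : w != 0 -> phi w != 0.
  by apply: contraNneq => w0; apply/eqP/phiI; rewrite rmorph0.
rewrite (frac_liftE v0 xv) (frac_liftE v'0 yv).
rewrite (@frac_liftE _ (u * v' - v * u') (v * v')) ?mulf_neq0 //.
  by rewrite subf_frac ?p0 // rmorphB !rmorphM.
by rewrite tofracB !tofracM -xv -yv; ring.
Qed.

Lemma frac_lift_monoid : monoid_morphism (frac_lift phiI).
Proof.
split=> [|x y]; first by rewrite -tofrac1 frac_lift_tofrac rmorph1.
have [u [v [v0 xv]]] := fracP x; have [u' [v' [v'0 yv]]] := fracP y.
rewrite (frac_liftE v0 xv) (frac_liftE v'0 yv).
rewrite (@frac_liftE _ (u * u') (v * v')) ?mulf_neq0 //.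
  by rewrite !rmorphM mulf_div.
by rewrite !tofracM -xv -yv mulrACA.
Qed.

HB.instance Definition _ :=
  GRing.isZmodMorphism.Build _ _ (frac_lift phiI) frac_lift_zmod.
HB.instance Definition _ :=
  GRing.isMonoidMorphism.Build _ _ (frac_lift phiI) frac_lift_monoid.

End FracLift.

(** If [f] does not divide [g], a Bezout relation between them evaluated at [u] yields 0 = 1. Thus
    [f] acts as the minimal polynomial of [u], up to a scalar. *)
Lemma irredp_dvdp_root (F M : fieldType) (iota : {rmorphism F -> M}) (u : M)
    (f g : {poly F}) : irreducible_poly f -> root (map_poly iota f) u ->
  root (map_poly iota g) u = (f %| g).
Proof.
move=> f_irr fu; apply/idP/idP => [gu|/dvdpP[q ->]]; last first.
  by rewrite rmorphM /= rootM fu orbT.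
apply: contraT => ng; have := irreducible_poly_coprime g f_irr.
rewrite ng => /Bezout_eq1_coprimepP[[a b] /= ab].
have := congr1 (fun p => (map_poly iota p).[u]) ab.
rewrite rmorphD !rmorphM rmorph1 hornerD !hornerM hornerC /=.
rewrite (rootP fu) (rootP gu) !mulr0 addr0 => /eqP.
by rewrite eq_sym oner_eq0.
Qed.

Section SimpleExtension.
Variables (F M : fieldType) (iota : {rmorphism F -> M}) (u : M) (f : {poly F}).
Hypotheses (f_irr : irreducible_poly f) (fu : root (map_poly iota f) u).

Local Notation ev g r := (map_poly iota g).[r].

Lemma simple_ext_inv x : (exists g, x = ev g u) -> exists g, x^-1 = ev g u.
Proof.
case=> g ->; have [gu|gu] := eqVneq (ev g u) 0.
  by exists 0; rewrite gu invr0 rmorph0 horner0.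
have : coprimep f g.
  by rewrite irreducible_poly_coprime // -(irredp_dvdp_root _ f_irr fu).
case/Bezout_eq1_coprimepP => [[a b] /= ab]; exists b.
have := congr1 (fun p => ev p u) ab.
rewrite rmorphD !rmorphM rmorph1 hornerD !hornerM hornerC /=.
by rewrite (rootP fu) mulr0 add0r => bg; rewrite -[LHS]mul1r -bg mulfK.
Qed.

Hypothesis gen : forall x, exists g, x = ev g u.

Let lc0 : lead_coef f != 0.
Proof. by rewrite lead_coef_eq0 irredp_neq0. Qed.

Let g_of x := projT1 (cid (gen x)).
Let g_ofE x : ev (g_of x) u = x.
Proof. by rewrite /g_of; case: cid. Qed.

(** [f] divides [g - h], so a coincidence at [u] propagates to every root of [f]. *)
Lemma simple_ext_eval g h r : root (map_poly iota f) r ->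
  ev g u = ev h u -> ev g r = ev h r.
Proof.
move=> fr /eqP; rewrite -subr_eq0 -hornerN -hornerD -rmorphB.
move/eqP/rootP; rewrite (irredp_dvdp_root _ f_irr fu) => /dvdpP[q e].
apply/eqP; rewrite -subr_eq0 -hornerN -hornerD -rmorphB e rmorphM hornerM.
by rewrite (rootP fr) mulr0.
Qed.

(* Independent of the choice of g_of x, and a ring morphism, only if r is a
   root of f. *)
Definition simple_ext_hom r x := ev (g_of x) r.

Lemma simple_ext_homE g r : root (map_poly iota f) r ->
  simple_ext_hom r (ev g u) = ev g r.
Proof. by move=> fr; apply: simple_ext_eval => //; apply: g_ofE. Qed.

Lemma simple_ext_rmorphism r : root (map_poly iota f) r ->
  exists2 s : {rmorphism M -> M}, s =1 simple_ext_hom r & forall a, s (iota a) = iota a.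
Proof.
move=> fr.
have sD : zmod_morphism (simple_ext_hom r).
  move=> x y; rewrite -[x]g_ofE -[y]g_ofE -hornerN -hornerD -rmorphB.
  by rewrite !simple_ext_homE // rmorphB hornerD hornerN.
have sM : monoid_morphism (simple_ext_hom r).
  split=> [|x y].
    by rewrite -[X in simple_ext_hom _ X](_ : ev 1 u = 1) ?simple_ext_homE // rmorph1 hornerC.
  rewrite -[x]g_ofE -[y]g_ofE -hornerM -rmorphM.
  by rewrite !simple_ext_homE // rmorphM hornerM.
pose zM := GRing.isZmodMorphism.Build _ _ _ sD.
pose mM := GRing.isMonoidMorphism.Build _ _ _ sM.
pose s : {rmorphism M -> M} := HB.pack (simple_ext_hom r) zM mM.
exists s => // a; have e : ev a%:P u = iota a by rewrite map_polyC hornerC.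
change (simple_ext_hom r (iota a) = iota a).
by rewrite -{1}e simple_ext_homE // map_polyC hornerC.
Qed.

Section Split.
Variable rs : seq M.
Hypotheses (rs_uniq : uniq rs) (rs_root : all (root (map_poly iota f)) rs).
Hypothesis rs_size : size rs = (size f).-1.

Let mem_rs r : (r \in rs) = root (map_poly iota f) r.
Proof.
have -> : map_poly iota f = lead_coef (map_poly iota f) *: \prod_(r <- rs) ('X - r%:P).
  apply: all_roots_prod_XsubC => //; last by rewrite uniq_rootsE.
  by rewrite size_map_poly rs_size prednK // size_poly_gt0 irredp_neq0.
by rewrite rootZ ?root_prod_XsubC // lead_coef_map fmorph_eq0.
Qed.

(** Write x = g(u) with deg g < deg f. Then g - x has all the deg f roots of [f], hence is zero, and
    x is the constant coefficient of g. *)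
Lemma simple_ext_fixed x :
  (forall r, r \in rs -> simple_ext_hom r x = x) -> exists a, x = iota a.
Proof.
move=> fx; have [g xg] := gen x.
have sg : (size (g %% f)%R < size f)%N by rewrite ltn_modp irredp_neq0.
have fg r : r \in rs -> ev (g %% f) r = x.
  rewrite mem_rs => fr; rewrite -(fx r) ?mem_rs // xg simple_ext_homE //.
  apply: simple_ext_eval => //; rewrite [in RHS](divp_eq g f).
  by rewrite rmorphD rmorphM hornerD hornerM (rootP fu) mulr0 add0r.
pose h := map_poly iota (g %% f) - x%:P; have h0 : h = 0.
  apply: contraTeq sg => h0; rewrite -leqNgt.
  have : all (root h) rs.
    apply/allP => r /fg e; apply/rootP.
    by rewrite /h hornerD hornerN hornerC e subrr.
  move=> /(max_poly_roots h0) /(_ rs_uniq); rewrite rs_size.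
  have := size_polyD (map_poly iota (g %% f)) (- x%:P).
  rewrite size_polyN size_map_poly size_polyC.
  move=> le lt; have := leq_trans lt le; rewrite prednK ?(ltnW f_irr.1) //.
  by rewrite leq_max leqNgt ltn_modp irredp_neq0 //= leqNgt (leq_ltn_trans (leq_b1 _) f_irr.1).
exists (g %% f)`_0; have := congr1 (fun p : {poly M} => p`_0) h0.
by rewrite /h coefB coefC eqxx coef_map coef0 => /eqP; rewrite subr_eq0 => /eqP.
Qed.

(** [ys] collects the conjugates of [x]. The conjugations permute them, so the product of the X - y
    has fixed coefficients, which come from [F]. *)
Lemma simple_ext_orbit_poly x :
  exists (p : {poly F}) (ys : seq M),
    [/\ uniq ys, x \in ys & map_poly iota p = \prod_(y <- ys) ('X - y%:P)].
Proof.
have [g xg] := gen x.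
pose ys := undup [seq ev g r | r <- rs].
have [p pE] : exists p, map_poly iota p = \prod_(y <- ys) ('X - y%:P).
  suff H i : exists a, (\prod_(y <- ys) ('X - y%:P))`_i = iota a.
    exists (\poly_(i < size (\prod_(y <- ys) ('X - y%:P))) projT1 (cid (H i))).
    apply/polyP => i; rewrite coef_map coef_poly; case: ltnP => [|le].
      by case: cid => a /= ->.
    by rewrite nth_default //; apply: rmorph0.
  apply: simple_ext_fixed => r rrs.
  have fr : root (map_poly iota f) r by rewrite -mem_rs.
  have [s s_hom s_id] := simple_ext_rmorphism fr.
  rewrite -s_hom -coef_map; congr (nth 0 (polyseq _) i).
  rewrite rmorph_prod (eq_bigr (fun y => 'X - (s y)%:P)); last first.
    by move=> y _; rewrite rmorphB /= map_polyX map_polyC.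
  rewrite -(big_map s xpredT (fun y => 'X - y%:P)); apply: perm_big.
  have us : uniq [seq s y | y <- ys] by rewrite map_inj_uniq ?undup_uniq //; apply: fmorph_inj.
  suff sub : {subset [seq s y | y <- ys] <= ys}.
    have [|_ e] := uniq_min_size us sub; first by rewrite size_map.
    by rewrite uniq_perm ?undup_uniq.
  move=> y0 /mapP[y]; rewrite mem_undup => /mapP[r' r'rs ->] ->.
  have sev q a : s (ev q a) = ev q (s a).
    rewrite -horner_map -map_poly_comp; congr (_.[_]).
    by apply: eq_map_poly => c; apply: s_id.
  rewrite sev mem_undup; apply: map_f; rewrite mem_rs; apply/rootP.
  by rewrite -sev; move: r'rs; rewrite mem_rs => /rootP ->; rewrite rmorph0.
exists p, ys; split=> //; first exact: undup_uniq.
by rewrite mem_undup xg; apply: map_f; rewrite mem_rs.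
Qed.

(** Each [x] is a root of its orbit polynomial, which splits with distinct roots; an irreducible
    polynomial with root [x] divides it and inherits both properties. *)
Lemma galois_simple_ext : galois_ext iota.
Proof.
split=> [x|m m_irr [x mx]|m m_irr [x mx]].
- have [p [ys [_ xys pE]]] := simple_ext_orbit_poly x.
  exists p; last by rewrite pE root_prod_XsubC.
  by rewrite -(map_poly_eq0 iota) pE monic_neq0 ?monic_prod_XsubC.
- have [p [ys [_ xys pE]]] := simple_ext_orbit_poly x.
  have : m %| p.
    by rewrite -(irredp_dvdp_root _ m_irr mx) pE root_prod_XsubC.
  rewrite -(dvdp_map iota) pE => /dvdp_prod_XsubC[k e].
  by exists (mask k ys).
- have [p [ys [uys xys pE]]] := simple_ext_orbit_poly x.
  have : m %| p.
    by rewrite -(irredp_dvdp_root _ m_irr mx) pE root_prod_XsubC.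
  rewrite -(separable_map iota) -(dvdp_map iota) pE => /dvdp_separable; apply.
  by rewrite separable_prod_XsubC.
Qed.

End Split.

(** [C] is the companion matrix of the monic multiple of [f]. It represents multiplication by X on
    F[X]/(f) and gives access to norms and characteristic polynomials. *)
Lemma simple_ext_matrix : exists e (C : 'M[F]_e.+1),
  size f = e.+2 /\ forall g, (horner_mx C g == 0) = (f %| g).
Proof.
pose f1 := (lead_coef f)^-1 *: f.
have f1m : f1 \is monic by rewrite monicE lead_coefZ mulVf.
have sf1 : size f1 = size f by rewrite size_scale // invr_eq0.
case sf : (size f) f_irr.1 => [|[|e]] // _.
have szC : (size f1).-1 = e.+1 by rewrite sf1 sf.
have [C chC] : exists C : 'M[F]_e.+1, char_poly C = f1.
  exists (castmx (szC, szC) (companionmx f1)).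
  by rewrite -[RHS](companionmxK f1m); case: _ / szC.
exists e, C; split=> // g.
have f1f : f1 %= f by rewrite eqp_scale // invr_eq0.
have Cf : horner_mx C f = 0.
  have -> : f = lead_coef f *: f1 by rewrite scalerA divff // scale1r.
  by rewrite linearZ /= -chC Cayley_Hamilton scaler0.
apply/eqP/idP => [Cg|/dvdpP[q ->]]; last by rewrite rmorphM /= Cf mulr0.
apply: contraT => ng; have := irreducible_poly_coprime g f_irr.
rewrite ng => /Bezout_eq1_coprimepP[[a b] /= ab].
have := congr1 (horner_mx C) ab.
rewrite rmorphD !rmorphM rmorph1 /= Cf Cg !mulr0 addr0 => /eqP.
by rewrite eq_sym oner_eq0.
Qed.

(* The element b is the norm of x, a determinant of a multiplication matrix. *)
Lemma simple_ext_norm_pow (x : M) (m : nat) (a : F) : x ^+ m = iota a ->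
  exists b : F, b ^+ m = a ^+ (size f).-1.
Proof.
move=> xm; have [g xg] := gen x.
have : f %| g ^+ m - a%:P.
  rewrite -(irredp_dvdp_root _ f_irr fu); apply/rootP.
  by rewrite rmorphB rmorphXn /= map_polyC hornerD hornerN hornerC horner_exp -xg xm subrr.
have [e [C [-> <-]]] := simple_ext_matrix.
rewrite rmorphB rmorphXn /= horner_mx_C subr_eq0 => /eqP/(congr1 determinant).
rewrite det_scalar => <-; exists (\det (horner_mx C g)).
by elim: (m) => [|k IH]; rewrite ?det1 // !exprS IH -det_mulmx.
Qed.

(** The characteristic polynomial of multiplication by [x] has the degree of [f] and kills [x] by
    Cayley-Hamilton. The degree bound is what [no_artin_schreier_root] relies on. *)
Lemma simple_ext_algebraic x :
  exists p : {poly F}, [/\ p != 0, (size p <= size f)%N & root (map_poly iota p) x].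
Proof.
have [g xg] := gen x; have [e [C [sf Cf]]] := simple_ext_matrix.
exists (char_poly (horner_mx C g)).
rewrite monic_neq0 ?char_poly_monic // size_char_poly sf; split=> //.
have : f %| char_poly (horner_mx C g) \Po g.
  rewrite -Cf (_ : horner_mx C (_ \Po g) = horner_mx (horner_mx C g) (char_poly (horner_mx C g))).
    by rewrite Cayley_Hamilton.
  elim/poly_ind: (char_poly _) => [|q c IH]; first by rewrite comp_poly0 !rmorph0.
  rewrite comp_polyD comp_polyM comp_polyX comp_polyC !rmorphD !rmorphM /= IH.
  by rewrite horner_mx_X !horner_mx_C.
rewrite -(irredp_dvdp_root _ f_irr fu) map_comp_poly /root horner_comp -xg.
by rewrite -[_ == 0]/(root _ _).
Qed.

End SimpleExtension.

Lemma algebraicOver_horner (F M : fieldType) (iota : {rmorphism F -> M})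
    (W : {poly F}) z :
  algebraicOver iota z -> algebraicOver iota (map_poly iota W).[z].
Proof.
move=> az; elim/poly_ind: W => [|p c IH].
  by rewrite rmorph0 horner0; apply: algebraic0.
rewrite rmorphD rmorphM /= map_polyX map_polyC hornerD hornerMX hornerC.
by apply: algebraic_add (algebraic_id _ _); apply: algebraic_mul.
Qed.

(* With beta / Y = W(z), multiplying the relation by W(z)^N, where N is its
   degree in Y, turns it into a polynomial relation for z alone; z being
   transcendental, this relation is trivial, so W divides the coefficient of
   Y^N. *)
Lemma transcendental_relation (F M : fieldType) (iota : {rmorphism F -> M})
    (Y z : M) (W : {poly F}) (b : F) (C : {poly {poly F}}) :
  (forall p : {poly F}, root (map_poly iota p) Y -> p = 0) -> b != 0 ->
  Y * (map_poly iota W).[z] = iota b ->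
  (forall j, size (C`_j)%R < size W)%N ->
  \sum_(j < size C) (map_poly iota C`_j).[z] * Y ^+ j = 0 -> C = 0.
Proof.
move=> Ytr b0 YW szC CYz; apply/eqP; apply: contraT => C0.
have ib0 : iota b != 0 by rewrite fmorph_eq0.
have Wz0 : (map_poly iota W).[z] != 0.
  by apply: contraNneq ib0 => Wz; rewrite -YW Wz mulr0.
have Y0 : Y != 0 by apply: contraNneq ib0 => Y0; rewrite -YW Y0 mul0r.
have ztr Q : root (map_poly iota Q) z -> Q = 0.
  move=> Qz; apply/eqP; apply: contraT => Q0.
  have az : algebraicOver iota z by exists Q.
  have [p p0 /Ytr p0'] : algebraicOver iota Y.
    rewrite -[Y](mulfK Wz0) YW.
    by apply: algebraic_div (algebraic_id _ _) _; apply: algebraicOver_horner.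
  by rewrite p0' eqxx in p0.
have [N sN] : exists N, size C = N.+1.
  by exists (size C).-1; rewrite prednK // size_poly_gt0.
pose Q := \sum_(j < N.+1) b ^+ j *: (C`_j * W ^+ (N - j)).
have Q0 : Q = 0.
  apply: ztr; apply/rootP; rewrite rmorph_sum horner_sum.
  have := congr1 ( *%R ((map_poly iota W).[z] ^+ N)) CYz.
  rewrite mulr0 sN mulr_sumr => e; rewrite -[RHS]e.
  apply: eq_bigr => j _; rewrite /= map_polyZ rmorphM rmorphXn /= hornerZ hornerM.
  rewrite horner_exp rmorphXn /= -YW exprMn.
  have -> : (map_poly iota W).[z] ^+ N =
    (map_poly iota W).[z] ^+ j * (map_poly iota W).[z] ^+ (N - j).
    by rewrite -exprD subnKC // -ltnS.
  ring.
have : W %| b ^+ N *: C`_N.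
  move/eqP: Q0; rewrite /Q big_ord_recr /= subnn expr0 mulr1 addrC addr_eq0 => /eqP ->.
  rewrite dvdpNr; apply: (big_ind (fun x => W %| x)) => [|x y|i _]; rewrite ?dvdp0 //.
    exact: dvdp_add.
  rewrite dvdpZr ?expf_neq0 // dvdp_mull //.
  by have := ltn_ord i; rewrite -subn_gt0; case: (N - i)%N => // k _; rewrite exprS dvdp_mulIl.
have CN0 : C`_N != 0 by rewrite -[N]/(N.+1.-1) -sN -lead_coefE lead_coef_eq0.
rewrite dvdpZr ?expf_neq0 // => /dvdp_leq => /(_ CN0).
by rewrite leqNgt szC.
Qed.

(** * Coordinates adapted to a projection *)

(** [w] has rank 1, so it is a multiple of the first row of the invertible [row_ebase w]; scaling
    and swapping two rows moves it to the end. *)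
Lemma unitmx_last_row (F : fieldType) m (w : 'rV[F]_m.+1) : w != 0 ->
  exists2 U, U \in unitmx & row ord_max U = w.
Proof.
move=> w0; have rw : \rank w = 1%N by apply/eqP; rewrite rank_rV w0.
pose a := (col_ebase w) 0 0.
have wE : w = a *: row 0 (row_ebase w).
  rewrite -[LHS](mulmx_ebase w) rw [col_ebase w]mx11_scalar -/a.
  rewrite -mulmxA mul_scalar_mx; congr (_ *: _).
  apply/rowP => j; rewrite !mxE (bigD1 0) //= big1 ?addr0 => [|i i0].
    by rewrite !mxE eqxx mul1r.
  rewrite !mxE /=; case: eqP => [e|_]; last by rewrite mul0r.
  by case/eqP: i0; apply: val_inj; exact: esym.
have a0 : a != 0 by apply: contraNneq w0 => a0; rewrite wE a0 scale0r.
exists (xrow ord_max 0 (a *: row_ebase w)).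
  rewrite xrowE unitmx_mul unitmx_perm unitmxZ ?unitfE //.
  exact: row_ebase_unit.
by apply/rowP => j; rewrite [in RHS]wE !mxE tpermL.
Qed.

Section Projections.
Variables (K : fieldType) (n : nat).
Implicit Types (P : 'rV[K]_n.+2) (A : 'M[K]_(n.+2, n.+1)).

(** Complete [P] to a basis with [P] last, and drop the last column of the inverse matrix. *)
Lemma exists_projection P : P != 0 -> exists A, projection_from P A.
Proof.
case/unitmx_last_row => U uU <-; have UV := mulmxV uU.
have e i : row i U *m col' ord_max (invmx U) = row i (col' ord_max 1%:M).
  by rewrite -row_mul !col'Esub mulmx_colsub UV.
exists (col' ord_max (invmx U)); split.
  by rewrite e; apply/rowP => j; rewrite !mxE (negPf (neq_lift _ _)).
apply/eqP; rewrite eqn_leq rank_leq_col col_leq_rank; apply/row_fullP.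
exists (row' ord_max U); rewrite row'Esub !col'Esub mul_rowsub_mx mulmx_colsub UV.
by apply/matrixP => i j; rewrite !mxE (inj_eq lift_inj).
Qed.

(* The columns of A and the column c are linear coordinates on K^(n+2): row_mx A c
   has the inverse col_mx B P, so that P is the point with coordinates 0 on A
   and 1 on c. *)
Definition projection_coordinates P A (c : 'cV[K]_n.+2) (B : 'M[K]_(n.+1, n.+2)) :=
  [/\ P *m A = 0, P *m c = 1%:M, B *m A = 1%:M, B *m c = 0
    & A *m B + c *m P = 1%:M].

Lemma exists_coordinates P A : P != 0 -> projection_from P A ->
  exists c B, projection_coordinates P A c B.
Proof.
move=> P0 [PA rA]; have [i Pi] : exists i, P 0 i != 0 by apply/rV0Pn.
pose c : 'cV[K]_n.+2 := (P 0 i)^-1 *: delta_mx i 0.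
have Pc : P *m c = 1%:M.
  rewrite -scalemxAr -colE; apply/rowP => j; rewrite !mxE.
  by rewrite mulVf // ord1.
have fA : row_full A by rewrite -col_leq_rank rA.
(* Subtracting multiples of [P] from the rows makes [c] vanish on them and leaves [B *m A]
   unchanged, since [A] kills [P]. *)
pose B := pinvmx A - pinvmx A *m c *m P.
have BA : B *m A = 1%:M.
  by rewrite mulmxBl mulVpmx // -(mulmxA _ P) PA mulmx0 subr0.
have Bc : B *m c = 0 by rewrite mulmxBl -(mulmxA _ P) Pc mulmx1 subrr.
exists c, B; split=> //.
(* The last identity is the product of the same two square matrices in the other order. *)
have H : col_mx P B *m row_mx c A = 1%:M.
  by rewrite mul_col_row PA Pc BA Bc -scalar_mx_block.
rewrite addrC; apply: etrans (esym (mul_row_col c A P B)) _.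
exact: (@mulmx1C _ n.+2 _ _ H).
Qed.

(** Since [v] vanishes at [P], it factors through any projection from [P]; a change of basis of the
    target makes it the last coordinate. *)
Lemma exists_projection_last P (v : 'cV[K]_n.+2) : P != 0 -> v != 0 ->
  P *m v = 0 -> exists2 A, projection_from P A & col ord_max A = v.
Proof.
move=> P0 v0 Pv; have [A pA] := exists_projection P0.
have [c [B [PA Pc BA Bc AB]]] := exists_coordinates P0 pA.
have Av : A *m (B *m v) = v.
  by have := congr1 (mulmx^~ v) AB; rewrite mulmxDl -!mulmxA Pv mulmx0 addr0 mul1mx.
have w0 : (B *m v)^T != 0.
  by apply: contraNneq v0 => /eqP; rewrite trmx_eq0 => /eqP w0; rewrite -Av w0 mulmx0.
have [U uU Uw] := unitmx_last_row w0.
exists (A *m U^T).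
  split; first by rewrite mulmxA PA mul0mx.
  by rewrite mxrankMfree ?pA.2 // row_free_unit unitmx_tr.
by apply: trmx_inj; rewrite tr_col trmx_mul trmxK row_mul Uw -trmx_mul Av.
Qed.

End Projections.

Lemma eq_mpoly_rmorph (R : comNzRingType) m (S : comNzRingType)
    (f g : {rmorphism {mpoly R[m]} -> S}) :
  (forall c, f c%:MP = g c%:MP) -> (forall i, f 'X_i = g 'X_i) -> f =1 g.
Proof.
move=> fgC fgX p; rewrite (mpolyE p) !rmorph_sum; apply: eq_bigr => k _ /=.
rewrite -mul_mpolyC !rmorphM /= fgC mpolyXE_id !rmorph_prod; congr (_ * _).
by apply: eq_bigr => i _; rewrite !rmorphXn /= fgX.
Qed.

Definition linear_form (R : nzRingType) m (v : 'I_m -> R) : {mpoly R[m]} :=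
  \sum_i v i *: 'X_i.

Lemma linear_form_homog (R : nzRingType) m (v : 'I_m -> R) :
  linear_form v \is 1.-homog.
Proof.
by apply: rpred_sum => i _; apply: rpredZ; rewrite dhomogX /= mdeg1.
Qed.

Lemma linear_form_eq0 (R : nzRingType) m (v : 'I_m -> R) :
  linear_form v = 0 -> forall i, v i = 0.
Proof.
move=> e i; have := congr1 (fun p : {mpoly R[m]} => p@_U_(i)) e.
rewrite /linear_form raddf_sum (bigD1 i) //= big1 => [|j ji].
  by rewrite addr0 mcoeffZ mcoeffX eqxx mulr1 mcoeff0.
rewrite mcoeffZ mcoeffX; case: eqP => [/mnmP/(_ j)|]; last by rewrite mulr0.
by rewrite !mnm1E eqxx eq_sym (negPf ji).
Qed.

Lemma subfield_restrict (F M : fieldType) (S : divringClosed F)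
    (T : divringClosed M) (Psi : {rmorphism F -> M}) :
  (forall x : subfield_of S, Psi (\val x) \in T) ->
  exists iota : {rmorphism subfield_of S -> subfield_of T},
    forall x, \val (iota x) = Psi (\val x).
Proof.
move=> PS; pose f x : subfield_of T := SubFieldOf (PS x).
have fE x : \val (f x) = Psi (\val x) by [].
have fD : zmod_morphism f.
  by move=> x y; apply: val_inj; rewrite [RHS]rmorphB !fE !rmorphB.
have fM : monoid_morphism f.
  split=> [|x y]; apply: val_inj; first by rewrite [RHS]rmorph1 fE !rmorph1.
  by rewrite [RHS]rmorphM !fE !rmorphM.
pose iota : {rmorphism subfield_of S -> subfield_of T} := HB.pack f
  (GRing.isZmodMorphism.Build _ _ _ fD) (GRing.isMonoidMorphism.Build _ _ _ fM).
by exists iota.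
Qed.

(** By induction on the polynomial, the denominator of each new coefficient is multiplied into the
    common one. [hom] stands for homogeneity of a given degree. *)
Lemma common_denominator (R : idomainType) (k : fieldType)
    (vk : {rmorphism k -> {fraction R}}) (hom : nat -> R -> Prop) :
  (forall d, hom d 0) -> hom 0%N 1 ->
  (forall d d' g h, hom d g -> hom d' h -> hom (d + d')%N (g * h)) ->
  (forall x, exists d g h, [/\ hom d g, hom d h, h != 0 & vk x = g%:F / h%:F]) ->
  forall p : {poly k}, exists d (h : R) (g : nat -> R),
    [/\ hom d h, h != 0 & forall i, hom d (g i) /\ vk p`_i = (g i)%:F / h%:F].
Proof.
move=> hom0 hom1 homM vkP; elim/poly_ind => [|p c [d [h [g [hd h0 gE]]]]].
  exists 0%N, 1, (fun=> 0); split; rewrite ?oner_neq0 // => i.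
  by rewrite coef0 rmorph0 tofrac0 mul0r.
have [d' [u [v [ud vd v0 cE]]]] := vkP c.
exists (d + d')%N, (h * v), (fun i => if i is j.+1 then g j * v else h * u).
split; [exact: homM | by rewrite mulf_neq0 | move=> i].
have h0' : h%:F != 0 by rewrite tofrac_eq0.
have v0' : v%:F != 0 by rewrite tofrac_eq0.
rewrite coefD coefMX coefC; case: i => [|i] /=.
  by split; [exact: homM | rewrite add0r cE !tofracM -mulf_div divff // mul1r].
have [gd gv] := gE i.
by split; [exact: homM | rewrite addr0 gv !tofracM -mulf_div divff // mulr1].
Qed.

(** * Function fields in homogeneous coordinates *)

Section HomogeneousCoordinates.
Variables (K : fieldType) (N : nat) (X : hypersurface K N).

Definition hs_fun (g : {mpoly K[N.+1]}) : {fraction coord_ring X} :=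
  (coord_proj X g)%:F.

HB.instance Definition _ := GRing.RMorphism.copy hs_fun
  (@FracField.tofrac (coord_ring X) \o coord_proj X).

Lemma hs_fun_eq0 g : hs_fun g = 0 -> exists h, g = h * hs_eq X.
Proof.
by move/eqP; rewrite /hs_fun tofrac_eq0 coord_proj_eq0 => /asboolP.
Qed.

Lemma hs_fun_hs_eq : hs_fun (hs_eq X) = 0.
Proof.
apply/eqP; rewrite /hs_fun tofrac_eq0 coord_proj_eq0.
by apply/asboolP; exists 1; rewrite mul1r.
Qed.

(* Equal to 0 unless g / h is a quotient of two forms of the same degree; so is
   ps_frac. *)
Definition ff_frac (g h : {mpoly K[N.+1]}) : function_field X :=
  insubd (0 : function_field X) (frac_of (coord_proj X) g h).

Lemma ff_fracE d g h : g \is d.-homog -> h \is d.-homog -> hs_fun h != 0 ->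
  \val (ff_frac g h) = hs_fun g / hs_fun h.
Proof.
move=> gd hd h0; rewrite insubdK //; apply/asboolP.
by exists d, g, h; split=> //; move: h0; rewrite tofrac_eq0.
Qed.

Lemma function_fieldP (x : function_field X) : exists d g h,
  [/\ g \is d.-homog, h \is d.-homog, hs_fun h != 0
     & \val x = hs_fun g / hs_fun h].
Proof.
case: x => x xS /=; have /asboolP[d [g [h [gd hd h0 ->]]]] := xS.
by exists d, g, h; rewrite tofrac_eq0.
Qed.

Definition ps_frac (g h : {mpoly K[N.+1]}) : proj_space_function_field K N :=
  insubd (0 : proj_space_function_field K N) (frac_of idfun g h).

Lemma ps_fracE d g h : g \is d.-homog -> h \is d.-homog -> h != 0 ->
  \val (ps_frac g h) = g%:F / h%:F.
Proof.
move=> gd hd h0; rewrite insubdK //; apply/asboolP.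
by exists d, g, h.
Qed.

Lemma ps_function_fieldP (x : proj_space_function_field K N) : exists d g h,
  [/\ g \is d.-homog, h \is d.-homog, h != 0 & \val x = g%:F / h%:F].
Proof.
case: x => x xS /=; have /asboolP[d [g [h [gd hd h0 ->]]]] := xS.
by exists d, g, h.
Qed.

Lemma ps_common_denominator (p : {poly (proj_space_function_field K N)}) :
  exists d (h : {mpoly K[N.+1]}) (g : nat -> {mpoly K[N.+1]}),
    [/\ h \is d.-homog, h != 0
       & forall i, g i \is d.-homog /\ \val p`_i = (g i)%:F / h%:F].
Proof.
refine (@common_denominator _ _ \val (fun d (g : {mpoly K[N.+1]}) => g \is d.-homog)
  _ _ _ (@ps_function_fieldP) p) => [d||d d' g h gd hd].
- exact: rpred0.
- exact: dhomog1.
- exact: dhomogM.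
Qed.

End HomogeneousCoordinates.

Lemma cancel_scaling (F : fieldType) (a b v w : F) : v != 0 ->
  a / v * b * (w * v) = a * (b * w).
Proof. by move=> v0; field. Qed.

Lemma cancel_denominators (F : fieldType) (a b v w x : F) : b != 0 -> w != 0 ->
  a * x * v = a / b * (v / w) * (b * (w * x)).
Proof. by move=> b0 w0; field; rewrite w0 b0. Qed.

(** If f = h g, one factor vanishes at [u]. By minimality its degree is not smaller than that of
    [f], so the other factor is constant. *)
Lemma irredp_of_minimal (F M : fieldType) (iota : {rmorphism F -> M}) u (f : {poly F}) :
  (1 < size f)%N -> root (map_poly iota f) u ->
  (forall g : {poly F}, (size g < size f)%N -> (map_poly iota g).[u] = 0 -> g = 0) ->
  irreducible_poly f.
Proof.
move=> s2 fu fmin; have f0 : f != 0 by rewrite -size_poly_gt0 ltnW.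
split=> // g g1 /dvdpP[h hg].
have := rootP fu; rewrite hg rmorphM hornerM /= => /eqP.
have [h0 g0] : h != 0 /\ g != 0.
  by split; apply: contraNneq f0 => e0; rewrite hg e0 ?mul0r ?mulr0.
rewrite mulf_eq0 => /orP[] /eqP ev0.
  have : (size f <= size h)%N.
    by rewrite leqNgt; apply: contraNN h0 => /fmin/(_ ev0) ->.
  rewrite hg size_mul //; move: g1 g0 h0; rewrite -!size_poly_gt0.
  by move: (size g) (size h) => a b; lia.
rewrite -dvdp_size_eqp ?dvdp_mull // -hg eqn_leq dvdp_leq //=; last by rewrite hg dvdp_mull.
by rewrite leqNgt; apply: contraNN g0 => /fmin/(_ ev0) ->.
Qed.

(** * From a homogeneous equation to a minimal polynomial *)

Section Dehomogenization.
Variables (R : idomainType) (k L M : fieldType) (hom : nat -> R -> Prop).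
Variables (vk : {rmorphism k -> {fraction R}}) (vL : {rmorphism L -> M}).
Variables (theta : {rmorphism R -> M}) (thetaI : injective theta).
Variables (iota : {rmorphism k -> L}).
Hypothesis iota_val : forall x, vL (iota x) = frac_lift thetaI (vk x).
Hypothesis vk_frac : forall d g h, hom d g -> hom d h -> h != 0 ->
  exists x, vk x = g%:F / h%:F.
Hypothesis vk_denominator : forall p : {poly k}, exists (h : R) (g : nat -> R),
  h != 0 /\ forall i, vk p`_i = (g i)%:F / h%:F.
Variables (x0 : R) (l : {poly R}) (d : nat) (s : M) (u : L).
Hypotheses (x0_neq0 : x0 != 0) (x0_hom : forall m, hom m (x0 ^+ m)).
Hypotheses (l_hom : forall i, hom (d - i)%N l`_i) (l_size : (1 < size l <= d.+1)%N).
Hypotheses (l_root : root (map_poly theta l) s).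
Hypothesis l_min : forall g : {poly R}, (size g < size l)%N ->
  (map_poly theta g).[s] = 0 -> g = 0.
Hypothesis uE : vL u = s / theta x0.

Let iota_frac x g h : vk x = g%:F / h%:F -> vL (iota x) = theta g / theta h.
Proof. by rewrite iota_val => ->; rewrite fmorph_div /= !frac_lift_tofrac. Qed.

Let theta_eq0 g : (theta g == 0) = (g == 0).
Proof. by rewrite -(inj_eq thetaI) rmorph0. Qed.

(** [f] is l(x0 X) / x0^d: its i-th coefficient l_i / x0^(d - i) is a quotient of forms of equal
    degree, hence comes from [k]. Minimality passes from [l] to [f] by clearing denominators. *)
Lemma dehomogenization : exists f : {poly k},
  [/\ size f = size l, irreducible_poly f, root (map_poly iota f) u
    & forall r, vL (map_poly iota f).[r] * theta x0 ^+ d = (map_poly theta l).[vL r * theta x0]].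
Proof.
have h0 : theta x0 != 0 by rewrite theta_eq0.
pose f : {poly k} := \poly_(i < size l)
  projT1 (cid (vk_frac (l_hom i) (x0_hom (d - i)) (expf_neq0 _ x0_neq0))).
have fE i : vk f`_i = (l`_i)%:F / (x0 ^+ (d - i))%:F.
  rewrite coef_poly; case: ltnP => [_|le]; first by case: cid.
  by rewrite nth_default // tofrac0 mul0r rmorph0.
have l0 : l != 0 by rewrite -size_poly_gt0; case/andP: l_size => /ltnW.
have sf : size f = size l.
  apply/eqP; rewrite eqn_leq size_poly /= leqNgt; apply/negP => lt.
  have : lead_coef l != 0 by rewrite lead_coef_eq0.
  rewrite lead_coefE -tofrac_eq0; apply/negP; rewrite negbK; apply/eqP.
  have := fE (size l).-1; rewrite nth_default; last first.
    by rewrite -ltnS prednK // size_poly_gt0.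
  move/esym/eqP; rewrite rmorph0 mulf_eq0 invr_eq0 !tofrac_eq0 (negPf (expf_neq0 _ x0_neq0)).
  by rewrite orbF => /eqP ->; rewrite tofrac0.
have f_eval r : vL (map_poly iota f).[r] * theta x0 ^+ d = (map_poly theta l).[vL r * theta x0].
  rewrite (@horner_coef_wide _ (size l)) -?sf ?size_map_poly //.
  rewrite (@horner_coef_wide _ (size l)) ?size_poly // sf.
  rewrite rmorph_sum mulr_suml; apply: eq_bigr => i _.
  rewrite rmorphM rmorphXn !coef_map /= (iota_frac (fE i)) exprMn rmorphXn.
  have le : (i <= d)%N.
    by rewrite -ltnS (leq_trans (ltn_ord i)) //; case/andP: l_size.
  have hq : theta x0 ^+ d = theta x0 ^+ i * theta x0 ^+ (d - i) by rewrite -exprD subnKC.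
  by rewrite hq; apply: cancel_scaling; rewrite expf_neq0.
have fu : root (map_poly iota f) u.
  have := f_eval u.
  rewrite uE divfK // (rootP l_root) => /eqP.
  by rewrite mulf_eq0 (negPf (expf_neq0 _ h0)) orbF fmorph_eq0.
exists f; split=> //; apply: (irredp_of_minimal _ fu) => [|g].
  by rewrite sf; case/andP: l_size.
rewrite sf => sg gu; have [h [a [h_neq0 gE]]] := vk_denominator g.
have th0 : theta h != 0 by rewrite theta_eq0.
(* Multiplying g(u) = 0 by h x0^(size g), with u = s / x0, gives G(s) = 0. Using [size g] rather
   than the degree only adds a factor x0. *)
pose G : {poly R} := \poly_(i < size g) (a i * x0 ^+ (size g - i)).
have G0 : G = 0.
  apply: l_min; first by apply: leq_ltn_trans sg; apply: size_poly.
  have /(congr1 (fun x => vL x * (theta h * theta x0 ^+ size g))) := gu.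
  rewrite rmorph0 mul0r => <-.
  rewrite (@horner_coef_wide _ (size g)); last first.
    by apply: leq_trans (size_poly _ _) _; apply: size_poly.
  rewrite (@horner_coef_wide _ (size g)) ?size_poly //.
  rewrite [X in _ = X * _]rmorph_sum mulr_suml; apply: eq_bigr => i _.
  rewrite rmorphM rmorphXn !coef_map /= (iota_frac (gE i)) coef_poly ltn_ord.
  rewrite uE rmorphM rmorphXn /= expr_div_n.
  have hq : theta x0 ^+ size g = theta x0 ^+ i * theta x0 ^+ (size g - i).
    by rewrite -exprD subnKC // ltnW.
  by rewrite hq; apply: cancel_denominators => //; apply: expf_neq0.
apply/polyP => i; rewrite coef0; have [lt|le] := ltnP i (size g); last first.
  by rewrite nth_default.
apply: (fmorph_inj vk); rewrite gE rmorph0; move/polyP/(_ i): G0.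
rewrite coef_poly lt coef0 => /eqP.
by rewrite mulf_eq0 (negPf (expf_neq0 _ x0_neq0)) orbF => /eqP ->; rewrite tofrac0 mul0r.
Qed.

End Dehomogenization.

(** * Generation of the function field by one element *)

Section Generation.
Variables (k L M : fieldType) (vL : {rmorphism L -> M}) (iota : {rmorphism k -> L}).
Variables (u : L) (f : {poly k}).
Hypotheses (f_irr : irreducible_poly f) (fu : root (map_poly iota f) u).

(** Membership is tested in [M], where the ratios of forms live before they are known to come from
    [L]. *)
Definition generated_by (x : M) := exists g : {poly k}, x = vL (map_poly iota g).[u].

Lemma generated_byD x y : generated_by x -> generated_by y -> generated_by (x + y).
Proof. by move=> [g ->] [h ->]; exists (g + h); rewrite rmorphD hornerD rmorphD. Qed.

Lemma generated_byM x y : generated_by x -> generated_by y -> generated_by (x * y).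
Proof. by move=> [g ->] [h ->]; exists (g * h); rewrite rmorphM hornerM rmorphM. Qed.

Lemma generated_by_iota a : generated_by (vL (iota a)).
Proof. by exists a%:P; rewrite map_polyC hornerC. Qed.

Lemma generated_by_gen : generated_by (vL u).
Proof. by exists 'X; rewrite map_polyX hornerX. Qed.

Variables (K : fieldType) (N : nat) (cl : {rmorphism {mpoly K[N]} -> M}) (h0 : M).
Hypotheses (h0_neq0 : h0 != 0) (genC : forall a, generated_by (cl a%:MP)).
Hypothesis genX : forall i, generated_by (cl 'X_i / h0).

(** Each monomial of [g] has degree [d], so dividing by [h0 ^+ d] makes it a product of the ratios
    X_i / h0. *)
Lemma generated_by_homog d (g : {mpoly K[N]}) :
  g \is d.-homog -> generated_by (cl g / h0 ^+ d).
Proof.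
move=> /dhomogP gd; rewrite (mpolyE g) rmorph_sum mulr_suml big_seq.
have gen1 : generated_by 1 by exists 1; rewrite rmorph1 hornerC rmorph1.
apply: (big_ind generated_by) => [|x y|m /gd /= md]; last 1 first.
- rewrite -mul_mpolyC rmorphM -mulrA; apply: generated_byM => //.
  rewrite -md mpolyXE_id rmorph_prod mdegE -prodrXr /= -prodf_div.
  apply: (big_ind generated_by) => [|x y|i _] //; first exact: generated_byM.
  rewrite rmorphXn -expr_div_n; elim: (m i) => [|j IH] //.
  by rewrite exprS; apply: generated_byM.
- by exists 0; rewrite rmorph0 horner0 rmorph0.
- exact: generated_byD.
Qed.

Lemma generated_by_fraction (x : L) d (g h : {mpoly K[N]}) :
  g \is d.-homog -> h \is d.-homog -> cl h != 0 -> vL x = cl g / cl h ->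
  exists g1 : {poly k}, x = (map_poly iota g1).[u].
Proof.
move=> gd hd hn0 xE.
have [[g1 g1E] [h1 h1E]] := (generated_by_homog gd, generated_by_homog hd).
have [h2 h2E] := simple_ext_inv f_irr fu (ex_intro _ h1 erefl).
exists (g1 * h2); apply: (fmorph_inj vL).
rewrite rmorphM hornerM rmorphM -h2E fmorphV -g1E -h1E xE.
by rewrite invf_div mulrA divfK ?expf_neq0.
Qed.

End Generation.

(** * The Fermat hypersurface on lines through a point *)

Lemma expfDq (R : comNzRingType) p e q (x y : R) : p \in [pchar R] ->
  q = (p ^ e)%N -> (x + y) ^+ q = x ^+ q + y ^+ q.
Proof.
move=> pR ->; apply: exprDn_pchar.
by rewrite (eq_pnat _ (pcharf_eq pR)) pnatX pnat_id // (pcharf_prime pR).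
Qed.

Lemma coef_line_shape (R : nzRingType) q (a b c d : R) i :
  ('X^(q.+1) * a%:P + 'X^q * b%:P + 'X * c%:P + d%:P)`_i =
  (i == q.+1)%:R * a + (i == q)%:R * b + (i == 1)%:R * c + (i == 0)%:R * d.
Proof.
rewrite !coefD !coefMC !coefXn coefX coefC.
by case: (i == 0)%N; rewrite ?mul1r ?mul0r.
Qed.

Lemma expand_line_term (R : comNzRingType) q (x c d : R) :
  (x + c * d) ^+ q = x ^+ q + (c * d) ^+ q ->
  (x + c * d) ^+ q.+1 =
  x ^+ q.+1 + (d * (c * x ^+ q) + d ^+ q * (c ^+ q * x) + d ^+ q.+1 * c ^+ q.+1).
Proof. by move=> xcd; rewrite !exprS xcd exprMn; ring. Qed.

Section ProjectionOfFermat.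
Variables (K : fieldType) (p e q n : nat).
Hypotheses (pK : p \in [pchar K]) (q_pow : q = (p ^ e)%N) (q_gt1 : (1 < q)%N).
Variables (n_gt0 : (0 < n)%N) (d_neq0 : q.+1%:R != 0 :> K).

Local Notation X := (fermat_hypersurface n_gt0 d_neq0).
Local Notation LL := {fraction coord_ring X}.
Local Notation Kh := {mpoly K[n.+1]}.
Local Notation Kx := {mpoly K[n.+2]}.
Local Notation cl := (hs_fun X).
Local Notation x_ i := (cl 'X_i).

(** This is the form b of the overview. It is also the differential of the Fermat form at [P], as (q
    + 1) P_i^q = P_i^q in characteristic p. *)
Definition pt_form (P : 'rV[K]_n.+2) : Kx := linear_form (fun i => P 0 i ^+ q).

Let pcharS (S : comNzRingType) (f : {rmorphism K -> S}) : p \in [pchar S].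
Proof. exact: rmorph_pchar f _ pK. Qed.

Lemma expfDq_poly m (x y : {poly {mpoly K[m]}}) : (x + y) ^+ q = x ^+ q + y ^+ q.
Proof. exact: expfDq (pcharS (@polyC _ \o @mpolyC m K)) q_pow. Qed.

Lemma expfDq_LL (x y : LL) : (x + y) ^+ q = x ^+ q + y ^+ q.
Proof. exact: expfDq (pcharS (cl \o @mpolyC _ K)) q_pow. Qed.

Section Coordinates.
Variables (P : 'rV[K]_n.+2) (A : 'M[K]_(n.+2, n.+1)).
Variables (c : 'cV[K]_n.+2) (B : 'M[K]_(n.+1, n.+2)).
Hypotheses (P_neq0 : P != 0) (PAcB : projection_coordinates P A c B).

(** As [A *m B + c *m P] is the identity, the coordinate x_i is this form in the coordinates x A,
    plus P_i times [cform]. *)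
Definition aff_form (i : 'I_n.+2) : Kh := linear_form (fun j => B j i).

Definition cform : Kx := linear_form (fun i => c i 0).

Local Notation compA := (comp_mpoly (linear_forms A)).

(* The coordinates (x A, x c) of K^(n+2), with 'X standing for the last one, so
   that moving along the lines through P only changes 'X. *)
Definition subst_line : Kx -> {poly Kh} :=
  mmap (@polyC _ \o @mpolyC n.+1 K)
    (fun i => (aff_form i)%:P + (P 0 i)%:MP%:P * 'X).

HB.instance Definition _ := GRing.RMorphism.on subst_line.

Lemma subst_lineC a : subst_line a%:MP = a%:MP%:P.
Proof. exact: mmapC. Qed.

Lemma subst_lineX i : subst_line 'X_i = (aff_form i)%:P + (P 0 i)%:MP%:P * 'X.
Proof. by rewrite /subst_line mmapX mmap1U. Qed.

Lemma subst_line_form (v : 'cV[K]_n.+2) : subst_line (linear_form (fun i => v i 0)) =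
  (linear_form (fun j => (B *m v) j 0))%:P + ((P *m v) 0 0)%:MP%:P * 'X.
Proof.
rewrite /linear_form rmorph_sum mxE !rmorph_sum /= mulr_suml.
transitivity (\sum_i
    ((\sum_j (v i 0 * B j i) *: 'X_j)%:P + (v i 0 * P 0 i)%:MP%:P * 'X : {poly Kh})).
  apply: eq_bigr => i _; rewrite -mul_mpolyC rmorphM /= subst_lineC subst_lineX.
  rewrite mulrDr mulrA -!rmorphM /=; congr (_%:P + _).
  by rewrite /aff_form /linear_form mulr_sumr; apply: eq_bigr => j _; rewrite mul_mpolyC scalerA.
rewrite [LHS]big_split; apply: (congr2 +%R); last first.
  by apply: eq_bigr => i _; rewrite [v i 0 * _]mulrC.
rewrite -!rmorph_sum /= exchange_big /=; congr (_ %:P).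
apply: eq_bigr => j _.
by rewrite -scaler_suml mxE; congr (_ *: _); apply: eq_bigr => i _; rewrite mulrC.
Qed.

Lemma comp_linear_forms j : compA 'X_j = linear_form (fun i => (col j A) i 0).
Proof.
rewrite /comp_mpoly mmapX mmap1U tnth_mktuple /linear_form.
by apply: eq_bigr => i _; rewrite mxE.
Qed.

(** Forms pulled back from the target are constant along the lines through [P]: this is
    [P *m A = 0], while [B *m A = 1%:M] recovers [g]. *)
Lemma subst_line_comp g : subst_line (compA g) = g%:P.
Proof.
case: PAcB => PA _ BA _ _.
pose s := [the {rmorphism Kh -> {poly Kh}} of subst_line \o compA].
apply: (@eq_mpoly_rmorph _ _ _ s (@polyC Kh)) g => [a|j]; rewrite /= ?comp_mpolyC.
  exact: subst_lineC.
rewrite comp_linear_forms subst_line_form colE !mulmxA BA PA mul1mx mul0mx mxE mpolyC0 mul0r addr0.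
congr (_ %:P); rewrite /linear_form (bigD1 j) //= big1 ?addr0 => [|i ij].
  by rewrite !mxE !eqxx scale1r.
by rewrite !mxE (negPf ij) scale0r.
Qed.

Lemma subst_line_cform : subst_line cform = 'X.
Proof.
case: PAcB => _ Pc _ Bc _.
rewrite /cform subst_line_form Pc Bc !mxE /= mpolyC1 mul1r.
by rewrite /linear_form big1 ?polyC0 ?add0r // => i _; rewrite mxE scale0r.
Qed.

Lemma mpolyX_coordinates i : compA (aff_form i) + P 0 i *: cform = 'X_i.
Proof.
case: PAcB => _ _ _ _ AB.
transitivity (\sum_l ((A *m B + c *m P) l i) *: 'X_l : Kx); last first.
  rewrite AB (bigD1 i) //= big1 ?addr0 => [|l li].
    by rewrite mxE eqxx scale1r.
  by rewrite mxE (negPf li) scale0r.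
under [RHS]eq_bigr do rewrite mxE scalerDl.
rewrite big_split /= /cform /aff_form /linear_form scaler_sumr; congr (_ + _); last first.
  by apply: eq_bigr => l _; rewrite scalerA mxE big_ord1 mulrC.
rewrite rmorph_sum /=.
under eq_bigr => j _ do rewrite comp_mpolyZ comp_linear_forms /linear_form scaler_sumr.
rewrite exchange_big /=; apply: eq_bigr => l _.
rewrite mxE scaler_suml; apply: eq_bigr => j _.
by rewrite scalerA mxE mulrC.
Qed.

Definition proj_fun (g : Kh) : LL := cl (compA g).

HB.instance Definition _ := GRing.RMorphism.copy proj_fun (cl \o compA).

Local Notation theta := proj_fun.
Local Notation S := (cl cform).

Lemma proj_funC a : theta a%:MP = cl a%:MP.
Proof. by rewrite /proj_fun comp_mpolyC. Qed.

Lemma x_coordinates i : theta (aff_form i) + cl (P 0 i)%:MP * S = x_ i.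
Proof. by rewrite /proj_fun -rmorphM mul_mpolyC -rmorphD mpolyX_coordinates. Qed.

(** The Fermat form along the line through [P] over a given point of the target. It turns out to be
    the minimal equation of [cform] on X over the target. *)
Definition line_poly := subst_line (fermat_poly K n.+2 q.+1).

Lemma line_poly_sum :
  line_poly = \sum_i ((aff_form i)%:P + (P 0 i)%:MP%:P * 'X) ^+ q.+1.
Proof.
rewrite /line_poly /fermat_poly [LHS](rmorph_sum subst_line).
by apply: eq_bigr => i _; rewrite [LHS](rmorphXn subst_line) /= subst_lineX.
Qed.

(** Shifting the parameter [S] by [d] moves the generic point x of X to x + d P. *)
Lemma line_poly_eval d : (map_poly theta line_poly).[S + d] =
  \sum_i (x_ i + cl (P 0 i)%:MP * d) ^+ q.+1.
Proof.
rewrite line_poly_sum rmorph_sum horner_sum; apply: eq_bigr => i _.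
rewrite rmorphXn horner_exp /= rmorphD rmorphM /= !map_polyC map_polyX.
rewrite hornerD hornerCM hornerX hornerC mulrDr addrA; congr ((_ + _) ^+ _).
  by rewrite -[RHS]x_coordinates; congr (_ + _ * _); apply: proj_funC.
by congr (_ * _); apply: proj_funC.
Qed.

Lemma line_poly_root : root (map_poly theta line_poly) S.
Proof.
apply/rootP; rewrite -[S]addr0 line_poly_eval -[RHS](hs_fun_hs_eq X).
by rewrite rmorph_sum; apply: eq_bigr => i _; rewrite mulr0 addr0 rmorphXn.
Qed.

(** If g(S) = 0 on X, the Fermat form divides g([cform]). [subst_line] turns this into a
    divisibility of [g] by [line_poly], impossible for a nonzero [g] of smaller degree. *)
Lemma line_poly_min (g : {poly Kh}) : (size g < size line_poly)%N ->
  (map_poly theta g).[S] = 0 -> g = 0.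
Proof.
move=> sg gS.
have : cl (map_poly compA g).[cform] = 0.
  by rewrite -horner_map -map_poly_comp.
move=> /hs_fun_eq0[h] /(congr1 subst_line).
rewrite rmorphM -horner_map -map_poly_comp /= subst_line_cform -/line_poly.
have -> : map_poly (subst_line \o compA) g = g^:P.
  by apply: eq_map_poly => a; rewrite /= subst_line_comp.
rewrite -/(comp_poly 'X g) comp_polyXr => gE.
apply/eqP; apply: contraTT sg => g0; rewrite -leqNgt gE.
move: (subst_line h) (line_poly) gE => w l gE.
have w0 : w != 0 by apply: contraNneq g0 => w0; rewrite gE w0 mul0r.
have l0 : l != 0 by apply: contraNneq g0 => l0; rewrite gE l0 mulr0.
rewrite size_mul //; move: w0; rewrite -size_poly_gt0.
by case: (size w) => // k _; rewrite addSn leq_addl.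
Qed.

Lemma line_polyE : line_poly = 'X^(q.+1) * (\sum_i P 0 i ^+ q.+1)%:MP%:P +
  'X^q * (\sum_i P 0 i ^+ q *: aff_form i)%:P +
  'X * (\sum_i P 0 i *: aff_form i ^+ q)%:P + (\sum_i aff_form i ^+ q.+1)%:P.
Proof.
rewrite line_poly_sum !rmorph_sum !mulr_sumr -!big_split.
apply: eq_bigr => i _; rewrite exprS expfDq_poly exprMn.
rewrite -!mul_mpolyC !rmorphM !rmorphXn /= !exprS.
by move: (_%:P) (_%:P) ('X) => u v w; ring.
Qed.

(** It vanishes exactly when [P] lies on X, and the projection then has degree q instead of q +
    1. *)
Definition pt_norm : K := \sum_i P 0 i ^+ q.+1.

Lemma sum_aff_form (w : 'I_n.+2 -> K) :
  \sum_i w i *: aff_form i = linear_form (fun j => (B *m \col_i w i) j 0).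
Proof.
rewrite /aff_form /linear_form; under eq_bigr do rewrite scaler_sumr.
rewrite exchange_big; apply: eq_bigr => j _; rewrite mxE scaler_suml.
by apply: eq_bigr => i _; rewrite scalerA !mxE mulrC.
Qed.

Lemma line_poly_coef i : line_poly`_i =
  (i == q.+1)%:R * pt_norm%:MP + (i == q)%:R * \sum_i P 0 i ^+ q *: aff_form i +
  (i == 1)%:R * \sum_i P 0 i *: aff_form i ^+ q + (i == 0)%:R * \sum_i aff_form i ^+ q.+1.
Proof.
by rewrite line_polyE coef_line_shape.
Qed.

Lemma line_poly_coef_homog i : line_poly`_i \is (q.+1 - i).-homog.
Proof.
have H m (g : Kh) : g \is (q.+1 - m).-homog -> (i == m)%:R * g \is (q.+1 - i).-homog.
  by case: eqP => [->|_]; rewrite ?mul1r ?mul0r ?rpred0.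
have h1 j := linear_form_homog (fun l => B l j).
rewrite line_poly_coef; do 3?apply: rpredD; apply: H.
- by rewrite subnn -[_%:MP]mulr1 mul_mpolyC; apply: rpredZ; apply: dhomog1.
- by rewrite subSnn; apply: rpred_sum => j _; apply: rpredZ; apply: h1.
- rewrite subn1; apply: rpred_sum => j _; apply: rpredZ; rewrite -{2}(mul1n q).
  by apply: dhomogMn; apply: h1.
- by rewrite subn0; apply: rpred_sum => j _; rewrite -{2}(mul1n q.+1); apply: dhomogMn; apply: h1.
Qed.

(** When F(P) = 0, the coefficient of X^q is nonzero by smoothness of X at [P]: the vector of the
    P_i^q is killed by [P], and if [B] killed it too, it would be zero. *)
Lemma size_line_poly : size line_poly = (q + (pt_norm != 0)).+1.
Proof.
have q0 : (q == 0)%N = false by case: (q) q_gt1.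
have q1 : (q == 1)%N = false by rewrite gtn_eqF.
have large i : (q.+1 < i)%N -> line_poly`_i = 0.
  move=> lt; rewrite line_poly_coef !gtn_eqF ?mul0r ?addr0 //; lia.
have cq1 : line_poly`_q.+1 = pt_norm%:MP.
  by rewrite line_poly_coef eqxx eqSS q0 gtn_eqF ?mul0r ?addr0 ?mul1r.
have cq : line_poly`_q = \sum_i P 0 i ^+ q *: aff_form i.
  by rewrite line_poly_coef ltn_eqF // eqxx q0 q1 ?mul0r ?addr0 add0r mul1r.
have [a0|a0] /= := eqVneq pt_norm 0.
  have lc : line_poly`_q != 0.
    rewrite cq sum_aff_form; apply: contraNneq P_neq0 => /linear_form_eq0 Bw.
    pose w : 'cV[K]_n.+2 := \col_i P 0 i ^+ q.
    have Bw0 : B *m w = 0 by apply/colP => j; rewrite Bw mxE.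
    have Pw0 : P *m w = 0.
      by apply/colP => j; rewrite !mxE -[RHS]a0 ord1; apply: eq_bigr => i _; rewrite mxE exprS.
    have w0 : w = 0.
      case: PAcB => _ _ _ _ AB; rewrite -[w]mul1mx -AB mulmxDl -!mulmxA Bw0 Pw0.
      by rewrite !mulmx0 addr0.
    apply/eqP/rowP => i; have := congr1 (fun M : 'cV[K]_n.+2 => M i 0) w0.
    by rewrite !mxE => /eqP; rewrite expf_eq0 => /andP[_ /eqP].
  rewrite addn0; apply/eqP; rewrite eqn_leq; apply/andP; split; last first.
    by rewrite ltnNge; apply: contraNN lc => le; rewrite nth_default.
  apply/leq_sizeP => j; rewrite leq_eqVlt => /orP[/eqP <-|/large //].
  by rewrite cq1 a0 mpolyC0.
rewrite addn1; apply/eqP; rewrite eqn_leq; apply/andP; split.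
  by apply/leq_sizeP => j /large.
rewrite ltnNge; apply: contraNN a0 => le.
by rewrite -(mpolyC_eq0 n.+1) -cq1 nth_default.
Qed.

(** A nonzero form whose pull-back vanishes on X would be a constant polynomial with root [S],
    against the minimality of [line_poly]. *)
Lemma proj_fun_inj : injective theta.
Proof.
apply: raddf_inj => g tg; apply/eqP; rewrite -polyC_eq0; apply/eqP.
apply: line_poly_min; last by rewrite map_polyC hornerC.
rewrite size_line_poly (leq_ltn_trans (size_polyC_leq1 _)) //.
by rewrite ltnS (leq_trans (ltnW q_gt1)) // leq_addr.
Qed.

Lemma proj_fun_eq0 g : (theta g == 0) = (g == 0).
Proof.
apply/eqP/eqP => [|->]; last exact: rmorph0.
by rewrite -[RHS](rmorph0 theta) => /proj_fun_inj.
Qed.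

Lemma comp_linear_forms_homog d g : g \is d.-homog -> compA g \is d.-homog.
Proof.
move=> /dhomogP gd; rewrite comp_mpolyEX big_seq; apply: rpred_sum => m /gd /= <-.
apply: rpredZ; rewrite mpolyXE_id rmorph_prod mdegE.
apply: (big_rec2 (fun (x : Kx) y => x \is y.-homog)).
  exact: dhomog1.
move=> i y x _ xy; apply: dhomogM => //; rewrite rmorphXn /= comp_linear_forms.
by have := dhomogMn (m i) (linear_form_homog (fun l => col i A l 0)); rewrite mul1n.
Qed.

Local Notation Psi := (frac_lift proj_fun_inj).
Local Notation kk := (proj_space_function_field K n).

Lemma frac_lift_pullback g h : Psi (g%:F / h%:F) = theta g / theta h.
Proof. by rewrite fmorph_div /= !frac_lift_tofrac. Qed.

Lemma exists_pullback :
  exists iota : {rmorphism kk -> function_field X}, pullback A iota.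
Proof.
have PS (x : kk) : Psi (\val x) \in degree0 (coord_proj X).
  pose proof (ps_function_fieldP x) as [d [g [h [gd hd hn0 xE]]]].
  rewrite xE; apply/asboolP; exists d, (compA g), (compA h).
  rewrite !comp_linear_forms_homog // frac_lift_pullback; split=> //.
  by rewrite -tofrac_eq0 -[_%:F]/(theta h) proj_fun_eq0.
pose proof (subfield_restrict PS) as [iota iotaE].
exists iota => d g h x _ _ _ xE.
have xE' : \val x = g%:F / h%:F := xE.
exact: etrans (iotaE x) (etrans (congr1 Psi xE') (frac_lift_pullback g h)).
Qed.

Section Pullback.
Variable iota : {rmorphism kk -> function_field X}.
Hypothesis iotaP : pullback A iota.

Lemma pullback_val x : \val (iota x) = Psi (\val x).
Proof.
pose proof (ps_function_fieldP x) as [d [g [h [gd hd h0 xE]]]].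
by rewrite xE frac_lift_pullback; apply: iotaP gd hd h0 xE.
Qed.

Lemma pullback_frac x g h : \val x = g%:F / h%:F -> \val (iota x) = theta g / theta h.
Proof. by move=> xE; rewrite pullback_val xE frac_lift_pullback. Qed.

Local Notation h0 := (theta 'X_ord0).

Let X0_neq0 m : 'X_ord0 ^+ m != 0 :> Kh.
Proof. by rewrite expf_neq0 // -msupp_eq0 msuppX. Qed.

Let X0_homog m : ('X_ord0 ^+ m : Kh) \is m.-homog.
Proof.
have h1 : ('X_ord0 : Kh) \is 1.-homog by rewrite dhomogX /= mdeg1.
by have := dhomogMn m h1; rewrite mul1n.
Qed.

Lemma h0_neq0 : h0 != 0.
Proof. by rewrite proj_fun_eq0; have := X0_neq0 1. Qed.

Definition affine_gen : function_field X := ff_frac X cform (compA 'X_ord0).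

Lemma affine_genE : \val affine_gen = S / h0.
Proof.
rewrite (@ff_fracE _ _ _ 1) ?linear_form_homog ?h0_neq0 //.
exact: comp_linear_forms_homog (X0_homog 1).
Qed.

Lemma affine_poly_exists : exists f : {poly kk},
  [/\ size f = size line_poly, irreducible_poly f, root (map_poly iota f) affine_gen
    & forall r, \val (map_poly iota f).[r] * h0 ^+ q.+1 = (map_poly theta line_poly).[\val r * h0]].
Proof.
refine (@dehomogenization Kh kk (function_field X) LL
  (fun d g => g \is d.-homog) \val \val theta proj_fun_inj iota pullback_val _ _
  'X_ord0 line_poly q.+1 S affine_gen (X0_neq0 1) X0_homog line_poly_coef_homog _
  line_poly_root line_poly_min affine_genE).
- by move=> d g h gd hd hn0; exists (ps_frac g h); apply: ps_fracE gd hd hn0.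
- move=> g; pose proof (ps_common_denominator g) as [d [h [f [_ hn0 fE]]]].
  by exists h, f; split=> // i; case: (fE i).
- rewrite size_line_poly; move: q_gt1; case: (_ != 0); lia.
Qed.

(** Each x_i / h0 is the sum of a function from the target and P_i times the generator. *)
Lemma affine_gen_gen (f : {poly kk}) :
  irreducible_poly f -> root (map_poly iota f) affine_gen ->
  forall x, exists g, x = (map_poly iota g).[affine_gen].
Proof.
move=> f_irr fu x.
pose proof (function_fieldP x) as [d [g [h [gd hd hn0 xE]]]].
have gen_frac d' a b : a \is d'.-homog -> b \is d'.-homog -> b != 0 ->
    generated_by \val iota affine_gen (theta a / theta b).
  move=> ad bd bn0; rewrite -frac_lift_pullback -(ps_fracE ad bd bn0) -pullback_val.
  exact: generated_by_iota.
have genC a : generated_by \val iota affine_gen (cl a%:MP).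
  have -> : cl a%:MP = theta a%:MP / theta 1 by rewrite rmorph1 divr1 proj_funC.
  apply: (gen_frac 0%N); rewrite ?oner_neq0 ?dhomog1 //.
  by rewrite -[a%:MP]mulr1 mul_mpolyC; apply: rpredZ; apply: dhomog1.
have genX i : generated_by \val iota affine_gen (x_ i / h0).
  rewrite -x_coordinates mulrDl -mulrA; apply: generated_byD.
    exact: gen_frac (linear_form_homog _) (X0_homog 1) (X0_neq0 1).
  apply: generated_byM; first exact: genC.
  by rewrite -affine_genE; apply: generated_by_gen.
exact: (generated_by_fraction f_irr fu h0_neq0 genC genX gd hd hn0 xE).
Qed.

End Pullback.
End Coordinates.
(** This is l^q in the notation of the overview; it avoids q-th roots, which need not exist in [K]
    here. *)
Definition conj_form (P : 'rV[K]_n.+2) : Kx := \sum_i P 0 i *: 'X_i ^+ q.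

(* The value of the Fermat form at x + d P, for x the generic point of X. *)
Definition line_eq (P : 'rV[K]_n.+2) (d : LL) : LL :=
  d * cl (conj_form P) + d ^+ q * cl (pt_form P) + d ^+ q.+1 * cl (pt_norm P)%:MP.

Lemma sum_line_eq (P : 'rV[K]_n.+2) d :
  \sum_i (x_ i + cl (P 0 i)%:MP * d) ^+ q.+1 = line_eq P d.
Proof.
have cE : cl (conj_form P) = \sum_i cl (P 0 i)%:MP * x_ i ^+ q.
  by rewrite /conj_form rmorph_sum; apply: eq_bigr => i _; rewrite -mul_mpolyC rmorphM rmorphXn.
have pE : cl (pt_form P) = \sum_i cl (P 0 i)%:MP ^+ q * x_ i.
  rewrite /pt_form /linear_form rmorph_sum; apply: eq_bigr => i _.
  by rewrite -mul_mpolyC !rmorphM !rmorphXn.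
have nE : cl (pt_norm P)%:MP = \sum_i cl (P 0 i)%:MP ^+ q.+1.
  by rewrite /pt_norm !rmorph_sum; apply: eq_bigr => i _; rewrite !rmorphXn.
have fE : \sum_i x_ i ^+ q.+1 = 0.
  rewrite -[RHS](hs_fun_hs_eq X) rmorph_sum.
  by apply: eq_bigr => i _; rewrite rmorphXn.
transitivity (\sum_i x_ i ^+ q.+1 + line_eq P d); last by rewrite fE add0r.
rewrite /line_eq cE pE nE !mulr_sumr -!big_split.
by apply: eq_bigr => i _; apply: expand_line_term; apply: expfDq_LL.
Qed.

(** The affine coordinate u = s / h along the lines through [P] generates the extension, and [r] is
    conjugate to it exactly when x + d P lies on X for d = r h - s. *)
Lemma projection_model P A (iota : {rmorphism proj_space_function_field K n -> function_field X}) :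
  P != 0 -> projection_from P A -> pullback A iota ->
  exists (u : function_field X) (f : {poly proj_space_function_field K n}) (s h : Kx),
  [/\ size f = (q + (pt_norm P != 0)).+1, irreducible_poly f, root (map_poly iota f) u,
      (forall x : function_field X, exists g, x = (map_poly iota g).[u])
    & [/\ s \is 1.-homog, h \is 1.-homog, cl h != 0, \val u = cl s / cl h
       & forall r, root (map_poly iota f) r <-> line_eq P (\val r * cl h - cl s) = 0]].
Proof.
move=> P0 pA iotaP; pose proof (exists_coordinates P0 pA) as [c [B PAcB]].
pose proof (affine_poly_exists P0 PAcB iotaP) as [f [sf f_irr fu fE]].
have h0 := h0_neq0 P0 PAcB.
exists (affine_gen A c), f, (cform c), (comp_mpoly (linear_forms A) 'X_ord0).
split; first by rewrite sf; exact: size_line_poly P0 PAcB.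
- exact: f_irr.
- exact: fu.
- move=> x; pose proof (affine_gen_gen P0 PAcB iotaP f_irr fu x) as [g gE].
  by exists g; exact: gE.
split; first exact: linear_form_homog.
- by rewrite comp_linear_forms; apply: linear_form_homog.
- exact: h0.
- exact: affine_genE P0 PAcB.
move=> r; have := fE r; rewrite -sum_line_eq -(line_poly_eval PAcB).
rewrite addrC subrK => <-.
split=> [/rootP -> |/eqP rE]; first by rewrite rmorph0 mul0r.
apply/rootP/eqP; move: rE.
by rewrite mulf_eq0 (negPf (expf_neq0 _ h0)) orbF fmorph_eq0.
Qed.

End ProjectionOfFermat.

(** * Two equations without solution in a rational function field *)

Lemma muni_mwiden (K : fieldType) n (c : {mpoly K[n]}) : muni (mwiden c) = c%:P.
Proof.
pose s := [the {rmorphism {mpoly K[n]} -> {poly {mpoly K[n]}}} of @muni n K \o @mwiden n K].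
apply: (@eq_mpoly_rmorph _ _ _ s (@polyC _)) c => [a|i].
  by rewrite /= mwidenC muniC.
rewrite /= mwidenX mnmwiden1 muniX.
have -> : widen_ord (leqnSn n) i = lift ord_max i.
  by apply/val_inj; rewrite /= /bump leqNgt ltn_ord.
by rewrite liftK.
Qed.

Lemma unmuniK (K : fieldType) n : cancel (@unmuni n K) (@muni n K).
Proof.
move=> p; rewrite /unmuni -horner_map /= muniX unlift_none -map_poly_comp.
rewrite -[RHS]comp_polyXr /comp_poly; congr (_.[_]).
by apply: eq_map_poly => c; apply: muni_mwiden.
Qed.

Lemma muni_linear_form (K : fieldType) n (w : 'I_n.+1 -> K) :
  muni (linear_form w) =
  (linear_form (fun i => w (lift ord_max i)))%:P + (w ord_max)%:MP%:P * 'X.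
Proof.
rewrite /linear_form rmorph_sum big_ord_recr /=; congr (_ + _).
  rewrite rmorph_sum; apply: eq_bigr => i _.
  have -> : widen_ord (leqnSn n) i = lift ord_max i.
    by apply/val_inj; rewrite /= /bump leqNgt ltn_ord.
  by rewrite -!mul_mpolyC !rmorphM /= muniC muniX liftK.
by rewrite -mul_mpolyC rmorphM /= muniC muniX unlift_none.
Qed.

(** Compare orders of vanishing at 0: s (q - 1) + q = t (q - 1), so q - 1 divides q, impossible for
    q > 2. *)
Lemma no_power_identity (F : fieldType) q (g h l : {poly F}) : (2 < q)%N ->
  g != 0 -> h != 0 -> ~~ ('X %| l) -> g ^+ q.-1 * 'X^q = l ^+ q * h ^+ q.-1 -> False.
Proof.
move=> q2 g0 h0 nl e; have X1 : (1 < size ('X : {poly F}))%N by rewrite size_polyX.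
have irrX : irreducible_poly ('X : {poly F}).
  by rewrite -['X]subr0; apply: irredp_XsubC.
have nM (a b : {poly F}) : ~~ ('X %| a) -> ~~ ('X %| b) -> ~~ ('X %| a * b).
  by move=> na; apply: contra; rewrite Gauss_dvdpr // irreducible_poly_coprime.
have nX (a : {poly F}) m : ~~ ('X %| a) -> ~~ ('X %| a ^+ m).
  move=> na; elim: m => [|m IH]; last by rewrite exprS nM.
  by rewrite dvdp1 size_polyX.
have [s [v [gE nv]]] := poly_val_ex X1 g0.
have [t [w [hE nw]]] := poly_val_ex X1 h0.
have : (s * q.-1 + q = t * q.-1)%N.
  apply: (@poly_val_uniq _ 'X (v ^+ q.-1) (l ^+ q * w ^+ q.-1)); rewrite ?polyX_eq0 ?nX ?nM ?nX //.
  move: e; rewrite gE hE !exprMn -!exprM exprD => e.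
  by rewrite mulrAC e mulrCA.
(* Here q becomes [q.+3], and the equation reads 1 = 0 modulo [q.+2]. *)
case: q q2 {e} => [|[|[|q]]] //= _ /(congr1 (modn^~ q.+2)).
by rewrite modnMl modnMDl -[q.+3]addn1 modnDl modn_small.
Qed.

Lemma frac_poly_denominator (R : idomainType) (p : {poly {fraction R}}) :
  exists (r : R) (p' : {poly R}),
    r != 0 /\ r%:F *: p = map_poly (@FracField.tofrac R) p'.
Proof.
elim/poly_ind: p => [|p c [r [p' [r0 IH]]]].
  by exists 1, 0; rewrite oner_neq0 scaler0 rmorph0.
have [u [v [v0 cE]]] := fracP c.
exists (r * v), (v%:P * p' * 'X + (r * u)%:P); split; first by rewrite mulf_neq0.
rewrite rmorphD [in RHS]rmorphM [in X in _ = X * _ + _]rmorphM /= map_polyX !map_polyC /= -IH.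
rewrite -!mul_polyC !tofracM -cE !rmorphM /=.
by move: (r%:F%:P) (v%:F%:P) => x y; ring.
Qed.

(** Over the fraction field of [R], the hypothesis reads Y W(Z) = k b with W = (X^q - X)^(q-1) - k
    w. The degree q (q - 1) of W exceeds the degree in Z of the relation, at most q + 1, so
    [transcendental_relation] applies. *)
Lemma no_artin_schreier (R : idomainType) (M : fieldType) (rho : {rmorphism R -> M})
    (Y Z : M) q (k b w : R) m (g : nat -> {poly R}) :
  injective rho -> (forall p : {poly R}, (map_poly rho p).[Y] = 0 -> p = 0) ->
  (2 < q)%N -> k != 0 -> b != 0 -> (m <= q.+2)%N ->
  Y * (Z ^+ q - Z) ^+ q.-1 = rho k * (rho b + rho w * Y) ->
  \sum_(i < m) (map_poly rho (g i)).[Y] * Z ^+ i = 0 ->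
  forall i, (i < m)%N -> g i = 0.
Proof.
move=> rhoI Ytr q2 k0 b0 mq YZ gYZ i im.
pose iota := [the {rmorphism {fraction R} -> M} of frac_lift rhoI].
have iotaE r : iota r%:F = rho r by apply: frac_lift_tofrac.
pose W : {poly {fraction R}} := ('X^q - 'X) ^+ q.-1 - (k * w)%:F%:P.
have sqX : size ('X^q - 'X : {poly {fraction R}}) = q.+1.
  by rewrite size_polyDl size_polyXn // size_polyN size_polyX; lia.
have sqXn : size (('X^q - 'X : {poly {fraction R}}) ^+ q.-1) = (q * q.-1).+1.
  have := size_exp ('X^q - 'X : {poly {fraction R}}) q.-1; rewrite sqX => <-.
  by rewrite prednK // size_poly_gt0 expf_neq0 // -size_poly_gt0 sqX.
have sW : size W = (q * q.-1).+1.
  rewrite size_polyDl sqXn // size_polyN (leq_ltn_trans (size_polyC_leq1 _)) //.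
  by rewrite ltnS muln_gt0; case: (q) q2 => [|[]].
pose G : {poly {poly {fraction R}}} := \poly_(j < m) map_poly (@FracField.tofrac R) (g j).
(* [G] is a polynomial in Z with coefficients in Y; exchanging the variables gives the polynomial in
   Y that [transcendental_relation] expects. *)
suff /(congr1 (fun C => (swapXY C)`_i)) : swapXY G = 0.
  rewrite swapXYK rmorph0 coef0 coef_poly im => gi0.
  have tI : injective (@FracField.tofrac R).
    by move=> a c /eqP; rewrite tofrac_eq => /eqP.
  by apply: (map_poly_injR tI); rewrite gi0 rmorph0.
have sC j : (size ((swapXY G)`_j)%R <= m)%N.
  by apply/leq_sizeP => l ml; rewrite coef_swapXY coef_poly ltnNge ml /= coef0.
have CE j l : (l < m)%N -> (swapXY G)`_j`_l = ((g l)`_j)%:F.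
  by move=> lm; rewrite coef_swapXY coef_poly lm coef_map.
apply: (@transcendental_relation _ _ iota Y Z W (k * b)%:F).
- move=> p pY; have [r [p' [r0 p'E]]] := frac_poly_denominator p.
  have p'0 : p' = 0.
    apply: Ytr; have -> : map_poly rho p' = map_poly iota (r%:F *: p).
      by rewrite p'E -map_poly_comp; apply: eq_map_poly => a; rewrite /= iotaE.
    by rewrite map_polyZ hornerZ (rootP pY) mulr0.
  move/eqP: p'E; rewrite p'0 rmorph0 scaler_eq0 tofrac_eq0 (negPf r0).
  by move/eqP.
- by rewrite tofrac_eq0 mulf_neq0.
- rewrite rmorphB rmorphXn rmorphB /= map_polyXn map_polyX map_polyC hornerD hornerN.
  rewrite horner_exp hornerD hornerN hornerXn hornerX hornerC mulrBr YZ.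
  by rewrite /= !frac_lift_tofrac !rmorphM; ring.
- move=> j; rewrite sW; apply: leq_ltn_trans (sC j) _.
  by case: (q) q2 mq => [|[|[|q']]] //= _; nia.
rewrite -[RHS]gYZ.
transitivity (\sum_(j < size (swapXY G)) \sum_(l < m) rho (g l)`_j * Z ^+ l * Y ^+ j).
  apply: eq_bigr => j _; rewrite (@horner_coef_wide _ m); last first.
    by apply: leq_trans (size_poly _ _) _.
  rewrite mulr_suml; apply: eq_bigr => l _.
  by rewrite coef_map CE // [_ (_%:F)]iotaE.
rewrite exchange_big; apply: eq_bigr => l _.
rewrite (@horner_coef_wide _ (size (swapXY G))); last first.
  apply: leq_trans (size_poly _ _) _; apply/leq_sizeP => j le.
  by apply/eqP; rewrite -tofrac_eq0 -(CE _ _ (ltn_ord l)) [(swapXY G)`_j]nth_default // coef0.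
by rewrite mulr_suml; apply: eq_bigr => j _; rewrite coef_map mulrAC.
Qed.

(** Take the last variable as X, over the fraction field in the others. The linear form involves
    another variable, so X does not divide it, and [no_power_identity] applies. *)
Lemma no_power_mpoly (K : fieldType) n q (w : 'I_n.+1 -> K) (g h : {mpoly K[n.+1]}) i :
  (2 < q)%N -> w (lift ord_max i) != 0 -> h != 0 ->
  g ^+ q.-1 * 'X_ord_max ^+ q = (- linear_form w) ^+ q * h ^+ q.-1 -> False.
Proof.
move=> q2 wi h0 e.
have lw0 : linear_form w != 0.
  by apply: contraNneq wi => /linear_form_eq0 ->.
have g0 : g != 0.
  apply: contraTneq (mulf_neq0 (expf_neq0 q (_ : - linear_form w != 0)) (expf_neq0 q.-1 h0)).
    move=> g0; rewrite -e g0 expr0n -subn1 subn_eq0 leqNgt (ltnW q2) mul0r eqxx.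
    by [].
  by rewrite oppr_eq0.
have [T [TI TX Tl]] : exists T : {rmorphism {mpoly K[n.+1]} -> {poly {fraction {mpoly K[n]}}}},
    [/\ forall p, (T p == 0) = (p == 0), T 'X_ord_max = 'X & ~~ ('X %| T (linear_form w))].
  exists [the {rmorphism _ -> _} of map_poly (@FracField.tofrac {mpoly K[n]}) \o @muni n K].
  split=> [p||] /=.
  - have tI : injective (map_poly (@FracField.tofrac {mpoly K[n]})).
      by apply: map_poly_injR => a b /eqP; rewrite tofrac_eq => /eqP.
    by rewrite -(can_eq (@muniK n K)) rmorph0 -(inj_eq tI) rmorph0.
  - by rewrite muniX unlift_none map_polyX.
  rewrite muni_linear_form rmorphD rmorphM /= !map_polyC map_polyX.
  rewrite dvdp_addl ?dvdp_mulIr // -['X]subr0 dvdp_XsubCl.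
  by rewrite rootC tofrac_eq0; apply: contraNneq wi => /linear_form_eq0/(_ i) ->.
apply: (@no_power_identity _ q (T g) (T h) (T (- linear_form w)) q2); rewrite ?TI //.
  by rewrite rmorphN dvdpNr.
by have := congr1 T e; rewrite !rmorphM !rmorphXn TX.
Qed.

Lemma horner_map_linear (R : nzRingType) (M : comNzRingType) (f : {rmorphism R -> M}) b c y :
  (map_poly f (b%:P + c%:P * 'X)).[y] = f b + f c * y.
Proof.
by rewrite rmorphD rmorphM /= !map_polyC map_polyX hornerD hornerCM hornerC hornerX.
Qed.

Section SecondProjection.
Variables (K : fieldType) (p e q n : nat).
Hypotheses (pK : p \in [pchar K]) (q_pow : q = (p ^ e)%N) (q_gt2 : (2 < q)%N).
Variables (n_gt0 : (0 < n)%N) (d_neq0 : q.+1%:R != 0 :> K).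

Local Notation X := (fermat_hypersurface n_gt0 d_neq0).
Local Notation LL := {fraction coord_ring X}.
Local Notation Kh := {mpoly K[n.+1]}.
Local Notation Kx := {mpoly K[n.+2]}.
Local Notation cl := (hs_fun X).
Local Notation L := (function_field X).
Local Notation kk := (proj_space_function_field K n).
Local Notation vec_form v := (linear_form (fun i => (v : 'cV[K]_n.+2) i 0)).

Let q_gt1 : (1 < q)%N := ltnW q_gt2.

(** Forms vanishing at [P] descend to the target of the projection. With [v2] as last coordinate
    there, [v1] must involve another variable, not being a multiple of [v2]. *)
Lemma second_projection (P : 'rV[K]_n.+2) (v1 v2 : 'cV[K]_n.+2) :
  P != 0 -> P *m v1 = 0 -> P *m v2 = 0 -> v2 != 0 ->
  (forall a, v1 <> a *: v2) ->
  exists A (iota : {rmorphism kk -> L}) (w : 'I_n.+1 -> K) (i : 'I_n),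
  [/\ projection_from P A, pullback A iota, injective (proj_fun n_gt0 d_neq0 A),
      (forall x g h, \val x = g%:F / h%:F ->
         \val (iota x) = proj_fun n_gt0 d_neq0 A g / proj_fun n_gt0 d_neq0 A h)
    & [/\ w (lift ord_max i) != 0,
          cl (vec_form v2) = proj_fun n_gt0 d_neq0 A 'X_ord_max
        & cl (vec_form v1) = proj_fun n_gt0 d_neq0 A (linear_form w)]].
Proof.
move=> P0 Pv1 Pv2 v2_0 v12.
have [A pA Av2] := exists_projection_last P0 v2_0 Pv2.
pose proof (exists_coordinates P0 pA) as [c [B PAcB]].
pose proof (exists_pullback pK q_pow q_gt1 n_gt0 d_neq0 P0 PAcB) as [iota iotaP].
have Av1 : A *m (B *m v1) = v1.
  case: PAcB => _ _ _ _ AB; have := congr1 (mulmx^~ v1) AB.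
  by rewrite mulmxDl -!mulmxA Pv1 mulmx0 addr0 mul1mx.
pose w i := (B *m v1) i 0.
have [i wi] : exists i : 'I_n, w (lift ord_max i) != 0.
  apply/existsP; apply: contraT => /existsPn w0; case: (v12 (w ord_max)).
  rewrite -Av1 -Av2 colE scalemxAr; congr (_ *m _).
  apply/colP => j; rewrite [RHS]mxE [X in _ * X]mxE -[LHS]/(w j).
  case: (unliftP ord_max j) => [j'|] ->.
    have /negPn/eqP -> := w0 j'; by rewrite eq_sym (negPf (neq_lift _ _)) mulr0.
  by rewrite !eqxx mulr1.
exists A, iota, w, i; split.
- exact: pA.
- exact: iotaP.
- refine (proj_fun_inj pK q_pow q_gt1 P0 PAcB).
- refine (pullback_frac pK q_pow q_gt1 P0 PAcB iotaP).
split=> //; first by rewrite /proj_fun comp_linear_forms Av2.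
rewrite /proj_fun; congr (cl _); rewrite {2}/linear_form rmorph_sum.
transitivity (\sum_i (A *m (B *m v1)) i 0 *: 'X_i : Kx).
  by rewrite Av1.
under [RHS]eq_bigr => j _ do rewrite /= comp_mpolyZ comp_linear_forms /linear_form scaler_sumr.
rewrite exchange_big; apply: eq_bigr => l _; rewrite mxE scaler_suml.
by apply: eq_bigr => j _; rewrite scalerA [col j A l 0]mxE mulrC.
Qed.

(** Since [P] lies on X, the projection has degree q, and - v1 / v2 comes from its target. Taking
    norms of z^(q-1) = - v1 / v2 makes (- v1 / v2)^q a (q-1)-th power of a rational function. *)
Lemma no_power_root (P : 'rV[K]_n.+2) (v1 v2 : 'cV[K]_n.+2) (z : L) :
  P != 0 -> pt_norm q P = 0 -> P *m v1 = 0 -> P *m v2 = 0 -> v2 != 0 ->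
  (forall a, v1 <> a *: v2) ->
  \val z ^+ q.-1 * cl (vec_form v2) = - cl (vec_form v1) -> False.
Proof.
move=> P0 NP Pv1 Pv2 v2_0 v12.
pose proof (second_projection P0 Pv1 Pv2 v2_0 v12)
  as [A [iota [w [i [pA iotaP thetaI iotaE [wi -> ->]]]]]].
pose proof (projection_model pK q_pow q_gt1 P0 pA iotaP)
  as [u [f [_ [_ [sf f_irr fu gen _]]]]].
rewrite NP eqxx addn0 in sf.
set theta := proj_fun n_gt0 d_neq0 A => zE.
have X0 : 'X_ord_max != 0 :> Kh by rewrite -msupp_eq0 msuppX.
have tX0 : theta 'X_ord_max != 0.
  by apply: contraNneq X0 => tX; apply/eqP/thetaI; rewrite -/theta tX /theta rmorph0.
pose x : kk := ps_frac (- linear_form w) 'X_ord_max.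
have xE : \val x = (- linear_form w)%:F / ('X_ord_max)%:F.
  apply: (ps_fracE (d := 1)) X0; last by rewrite dhomogX /= mdeg1.
  by rewrite rpredN linear_form_homog.
have zx : z ^+ q.-1 = iota x.
  apply: val_inj; rewrite rmorphXn (iotaE _ _ _ xE) /= -/theta.
  by apply: (mulIf tX0); rewrite zE divfK // /theta rmorphN.
pose proof (simple_ext_norm_pow f_irr fu gen zx) as [b bE].
pose proof (ps_function_fieldP b) as [d [g [h [_ _ h0 gh]]]].
move/(congr1 \val): bE; rewrite !rmorphXn /= gh xE sf /= => bE.
apply: (no_power_mpoly (g := g) q_gt2 wi h0); apply/eqP.
rewrite -tofrac_eq !tofracM !tofracXn; apply/eqP.
move: bE; rewrite !expr_div_n => /eqP; rewrite eqr_div ?expf_neq0 ?tofrac_eq0 //.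
by move/eqP.
Qed.

(** Project from a common zero [P] of [v1] and [v2]: [z] has degree at most q + 1 over the function
    field of the target. The last coordinate of the target plays Y, and the polynomials in the
    others form the ring [R] of [no_artin_schreier]. *)
Lemma no_artin_schreier_root (P : 'rV[K]_n.+2) (v1 v2 : 'cV[K]_n.+2) (z : L) k :
  P != 0 -> P *m v1 = 0 -> P *m v2 = 0 -> v2 != 0 ->
  (forall a, v1 <> a *: v2) -> k != 0 ->
  (\val z ^+ q - \val z) ^+ q.-1 * cl (vec_form v2) = cl k%:MP * cl (vec_form v1) -> False.
Proof.
move=> P0 Pv1 Pv2 v2_0 v12 k0.
pose proof (second_projection P0 Pv1 Pv2 v2_0 v12)
  as [A [iota [w [i [pA iotaP thetaI iotaE [wi -> ->]]]]]].
pose proof (projection_model pK q_pow q_gt1 P0 pA iotaP)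
  as [u [f [_ [_ [sf f_irr fu gen _]]]]].
rewrite -(proj_funC n_gt0 d_neq0 A).
set theta := proj_fun n_gt0 d_neq0 A => zE.
pose rho := [the {rmorphism {mpoly K[n]} -> LL} of theta \o @mwiden n K].
have theta_muni g : theta g = (map_poly rho (muni g)).[theta 'X_ord_max].
  rewrite -{1}[g]muniK /unmuni /theta -horner_map -map_poly_comp.
  by [].
have rhoI : injective rho.
  move=> x y /thetaI; move/(congr1 (@muni n K)); rewrite !muni_mwiden.
  exact: polyC_inj.
have Ytr (a : {poly {mpoly K[n]}}) : (map_poly rho a).[theta 'X_ord_max] = 0 -> a = 0.
  rewrite -[a]unmuniK -theta_muni => ta.
  suff -> : unmuni a = 0 by rewrite rmorph0.
  by apply: thetaI; rewrite -/theta ta /theta rmorph0.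
pose proof (simple_ext_algebraic f_irr fu gen z) as [a [a0 sa az]].
pose proof (ps_common_denominator a) as [d [h [g [_ h0 gE]]]].
have th0 : theta h != 0.
  by apply: contraNneq h0 => th; apply/eqP/thetaI; rewrite -/theta th /theta rmorph0.
pose b := linear_form (fun i => w (lift ord_max i)).
have b0 : b != 0 by apply: contraNneq wi => /linear_form_eq0 ->.
have sum0 : \sum_(j < size a) (map_poly rho (muni (g j))).[theta 'X_ord_max] * \val z ^+ j = 0.
  have := rootP az; rewrite (@horner_coef_wide _ (size a)) ?size_poly //.
  move=> /(congr1 (fun x => \val x * theta h)); rewrite rmorph0 mul0r => e0.
  rewrite -[RHS]e0 rmorph_sum mulr_suml; apply: eq_bigr => j _.
  rewrite rmorphM rmorphXn coef_map /= (iotaE _ _ _ (gE j).2) -/theta -theta_muni.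
  by rewrite mulrAC divfK.
have YZ : theta 'X_ord_max * (\val z ^+ q - \val z) ^+ q.-1 =
    rho k%:MP * (rho b + rho (w ord_max)%:MP * theta 'X_ord_max).
  have kE : theta k%:MP = rho k%:MP by rewrite /rho /= mwidenC.
  by rewrite mulrC zE kE [theta (linear_form w)]theta_muni muni_linear_form horner_map_linear.
have sq : (size a <= q.+2)%N.
  by apply: leq_trans sa _; rewrite sf ltnS -addn1 leq_add2l leq_b1.
have k0' : k%:MP != 0 :> {mpoly K[n]} by rewrite mpolyC_eq0.
pose proof (@no_artin_schreier {mpoly K[n]} LL rho (theta 'X_ord_max) (\val z) q
  k%:MP b (w ord_max)%:MP (size a) (fun j => muni (g j)) rhoI Ytr q_gt2 k0' b0 sq
  YZ sum0) as g0.
case/negP: a0; apply/eqP/polyP => j; rewrite coef0.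
have [lt|le] := ltnP j (size a); last by rewrite nth_default.
have gj : g j = 0 by rewrite -[g j]muniK g0 // /unmuni rmorph0 horner0.
by apply: val_inj; rewrite (gE j).2 gj tofrac0 mul0r rmorph0.
Qed.

End SecondProjection.

(** * Galois points *)

(* With w_i = (y_i h)^-1 and D = w_3 - w_2, the two relations give
   z^q = w_2 / D, whereas z = (w_2 + al / l) / D. *)
Lemma artin_schreier_of_roots (M : fieldType) q (a b l al h y2 y3 : M) : (0 < q)%N ->
  (forall x y : M, (x + y) ^+ q = x ^+ q + y ^+ q) ->
  l != 0 -> h != 0 -> y2 != 0 -> y3 != 0 -> y2 != y3 -> al ^+ q = a ->
  (forall y, y = y2 \/ y = y3 ->
     y * h * l ^+ q + (y * h) ^+ q * b + (y * h) ^+ q.+1 * a = 0) ->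
  let z := (y2^-1 + al * (h / l)) / (y3^-1 - y2^-1) in
  (z ^+ q - z) ^+ q.-1 * b = - (- al) ^+ q.-1 * l.
Proof.
case: q => // q _ Fr l0 h0 y20 y30 y23 <- ylin z.
have FrB (x y : M) : (x - y) ^+ q.+1 = x ^+ q.+1 - y ^+ q.+1.
  by rewrite -[in RHS](subrK y x) [X in _ = X - _]Fr addrK.
pose w2 := (y2 * h)^-1; pose D := (y3 * h)^-1 - w2.
have D0 : D != 0.
  rewrite subr_eq0 (inj_eq invr_inj) (inj_eq (mulIf h0)) eq_sym.
  exact: y23.
have weq y : y != 0 -> y = y2 \/ y = y3 ->
    l ^+ q.+1 * (y * h)^-1 ^+ q.+1 + b * (y * h)^-1 + al ^+ q.+1 = 0.
  move=> y0 /ylin; move: (mulf_neq0 y0 h0) => {y0}; move: (y * h) => d d0 e.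
  apply: (mulIf (expf_neq0 q.+2 d0)); rewrite mul0r -[RHS]e exprVn !exprS.
  by field; rewrite d0 expf_neq0.
have w2e := weq _ y20 (or_introl erefl); have w3e := weq _ y30 (or_intror erefl).
have lDD : l ^+ q.+1 * D ^+ q.+1 = - b * D.
  have e0 : l ^+ q.+1 * (y3 * h)^-1 ^+ q.+1 + b * (y3 * h)^-1 + al ^+ q.+1 -
     (l ^+ q.+1 * w2 ^+ q.+1 + b * w2 + al ^+ q.+1) = 0 by rewrite w2e w3e subrr.
  apply/eqP; rewrite -subr_eq0; apply/eqP; rewrite -[RHS]e0 FrB /D.
  by move: (l ^+ _) (_^-1 ^+ _) (w2 ^+ _) => x1 x2 x3; ring.
have lD : l ^+ q.+1 * D ^+ q = - b.
  by apply: (mulIf D0); rewrite -mulrA -exprSr lDD.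
have zE : z = (w2 + al / l) / D.
  have -> : w2 + al / l = h^-1 * (y2^-1 + al * (h / l)).
    by rewrite /w2; field; rewrite l0 h0 y20.
  have -> : D = h^-1 * (y3^-1 - y2^-1) by rewrite /D /w2; field; rewrite h0 y20 y30.
  by rewrite -mulf_div divff ?invr_eq0 // mul1r.
have lq : l ^+ q != 0 by rewrite expf_neq0.
have Dq : D ^+ q != 0 by rewrite expf_neq0.
have b0 : b != 0 by rewrite -oppr_eq0 -lD mulf_neq0 ?expf_neq0.
have lq1 : l ^+ q.+1 != 0 by rewrite expf_neq0.
have zq : z ^+ q.+1 = w2 / D.
  have w2q : l ^+ q.+1 * (w2 + al / l) ^+ q.+1 = - b * w2.
    rewrite Fr expr_div_n mulrDr [X in _ + X = _]mulrC divfK //.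
    by apply/eqP; rewrite mulNr -addr_eq0 addrAC; apply/eqP.
  apply/eqP; rewrite zE expr_div_n eqr_div ?expf_neq0 //; apply/eqP.
  by apply: (mulfI lq1); rewrite mulrA w2q mulrCA lDD; ring.
rewrite zq zE /= -mulrBl opprD addrA subrr add0r expr_div_n.
rewrite -[b]opprK -lD -[- (al / l)]mulNr expr_div_n exprS.
by move: ((- al) ^+ q) => x1; field; rewrite lq Dq.
Qed.

Lemma sum_expfDq (R : comNzRingType) p e q m (F : 'I_m -> R) : p \in [pchar R] ->
  q = (p ^ e)%N -> (\sum_i F i) ^+ q = \sum_i F i ^+ q.
Proof.
move=> pR qE; apply: (big_morph (fun x => x ^+ q)) => [x y|].
  exact: expfDq pR qE.
by rewrite expr0n gtn_eqF // qE expn_gt0 prime_gt0 // (pcharf_prime pR).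
Qed.

(** Divide the equation by d l^(q-1). *)
Lemma power_of_root (M : fieldType) q (b l d : M) : (0 < q)%N -> l != 0 -> d != 0 ->
  d * l ^+ q + d ^+ q * b = 0 -> (d / l) ^+ q.-1 * b = - l.
Proof.
case: q => // q _ l0 d0 e; apply: (mulfI d0); apply: (mulIf (expf_neq0 q l0)) => /=.
apply/eqP; rewrite -subr_eq0; apply/eqP; rewrite -[RHS]e expr_div_n !exprS.
by field; rewrite expf_neq0.
Qed.

Lemma subf_div_mul (F : fieldType) (x s h : F) : h != 0 -> (x - s / h) * h = x * h - s.
Proof. by move=> h0; rewrite mulrBl divfK. Qed.

Lemma rmorph_slope (F M : fieldType) (f : {rmorphism F -> M}) (x y s t : F) :
  f ((x^-1 + s * t) / (y^-1 - x^-1)) =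
  ((f x)^-1 + f s * f t) / ((f y)^-1 - (f x)^-1).
Proof. by rewrite fmorph_div rmorphD rmorphB !fmorphV rmorphM. Qed.

(** When l and b coincide, putting d = m b in the line equation leaves b^(q+1) times an equation on
    the constant m. *)
Lemma line_term_root (R : comNzRingType) q (m a b : R) :
  m + m ^+ q + m ^+ q.+1 * a = 0 ->
  m * b * b ^+ q + (m * b) ^+ q * b + (m * b) ^+ q.+1 * a = 0.
Proof. by move=> e; rewrite -[RHS](mulr0 (b * b ^+ q)) -[in RHS]e !exprMn !exprS; ring. Qed.

Lemma divf_mul_sub (F : fieldType) (x s h : F) : h != 0 -> (s + x) / h * h - s = x.
Proof. by move=> h0; rewrite divfK // addrAC subrr add0r. Qed.

Lemma two_other_mem (T : eqType) (s : seq T) x : uniq s -> (2 < size s)%N -> x \in s ->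
  exists y z, [/\ y \in s, z \in s, y != z, y != x & z != x].
Proof.
move=> us ss xs; have : perm_eq s (x :: rem x s) by exact: perm_to_rem.
case: (rem x s) => [|y [|z t]] sE; first by rewrite (perm_size sE) in ss.
  by rewrite (perm_size sE) in ss.
move: us; rewrite (perm_uniq sE) /= !inE !negb_or => /and3P[/and3P[xy xz _] /andP[yz _] _].
exists y, z; rewrite !(perm_mem sE) !inE !eqxx !orbT yz.
by rewrite ![_ == x]eq_sym xy xz.
Qed.

Section Rationality.
Variables (K : fieldType) (p e q n : nat).
Hypotheses (pK : p \in [pchar K]) (q_pow : q = (p ^ e)%N) (q_gt2 : (2 < q)%N).
Variables (n_gt0 : (0 < n)%N) (d_neq0 : q.+1%:R != 0 :> K).

Local Notation X := (fermat_hypersurface n_gt0 d_neq0).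
Local Notation LL := {fraction coord_ring X}.
Local Notation Kh := {mpoly K[n.+1]}.
Local Notation Kx := {mpoly K[n.+2]}.
Local Notation cl := (hs_fun X).
Local Notation L := (function_field X).
Local Notation kk := (proj_space_function_field K n).
Local Notation vec_form v := (linear_form (fun i => (v : 'cV[K]_n.+2) i 0)).

Let q_gt1 : (1 < q)%N := ltnW q_gt2.

Lemma hs_const_inj (a b : K) : cl a%:MP = cl b%:MP -> a = b.
Proof.
move=> /eqP; rewrite -subr_eq0 -!rmorphB => /eqP ab0; apply/eqP; rewrite -subr_eq0.
apply: contraT => ab; have := congr1 ( *%R (cl (a - b)^-1%:MP)) ab0.
by rewrite mulr0 -!rmorphM mulVf // !rmorph1 => /eqP; rewrite oner_eq0.
Qed.

Lemma exists_left_kernel m (V : 'M[K]_(n.+2, m)) : (m < n.+2)%N ->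
  exists2 P : 'rV[K]_n.+2, P != 0 & P *m V = 0.
Proof.
move=> mn; have : kermx V != 0.
  rewrite -mxrank_eq0 mxrank_ker subn_eq0 -ltnNge.
  by apply: leq_ltn_trans mn; apply: rank_leq_col.
rewrite -nz_row_eq0 => nz; exists (nz_row (kermx V)) => //.
by apply/sub_kermxP; apply: nz_row_sub.
Qed.

(** Project from a zero of [v]: the form becomes the pull-back of a coordinate of the target, and
    pull-back is injective. *)
Lemma hs_vec_form_neq0 (v : 'cV[K]_n.+2) : v != 0 -> cl (vec_form v) != 0.
Proof.
move=> v0; have [P P0 Pv] := exists_left_kernel v (isT : (1 < n.+2)%N).
have [A pA Av] := exists_projection_last P0 v0 Pv.
pose proof (exists_coordinates P0 pA) as [c [B PAcB]].
have X0 : 'X_ord_max != 0 :> Kh by rewrite -msupp_eq0 msuppX.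
have := X0; rewrite -(proj_fun_eq0 pK q_pow q_gt1 n_gt0 d_neq0 P0 PAcB).
by rewrite /proj_fun comp_linear_forms Av.
Qed.

Lemma conj_formE (P Q : 'rV[K]_n.+2) : (forall i, Q 0 i ^+ q = P 0 i) ->
  conj_form q P = vec_form (\col_i Q 0 i) ^+ q.
Proof.
move=> QP; rewrite /conj_form /linear_form (sum_expfDq _ (rmorph_pchar (@mpolyC _ K) pK) q_pow).
by apply: eq_bigr => i _; rewrite exprZn mxE QP.
Qed.

Lemma pt_formE (P : 'rV[K]_n.+2) : pt_form q P = vec_form (\col_i P 0 i ^+ q).
Proof. by apply: eq_bigr => i _; rewrite mxE. Qed.

(** With l = [v1] and b = [v2], the line equation is d l^q + d^q b + d^(q+1) al^q = 0. Being Galois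
    puts at least three distinct conjugates of [u] in the function field, as q > 2. Their
    differences contradict [no_power_root] or [no_artin_schreier_root] when l and b are
    independent. *)
Lemma galois_dependent (P Q : 'rV[K]_n.+2) (al : K) : P != 0 ->
  (forall i, Q 0 i ^+ q = P 0 i) -> al ^+ q = pt_norm q P -> galois_point X P ->
  exists a, (\col_i Q 0 i) = a *: (\col_i P 0 i ^+ q).
Proof.
move=> P0 QP alq [A pA [iota iotaP [_ norm sep]]]; apply: contrapT => indep.
set v1 := (\col_i Q 0 i) in indep; set v2 := (\col_i P 0 i ^+ q) in indep.
have v12 a : v1 <> a *: v2 by move=> v1E; apply: indep; exists a.
have v20 : v2 != 0.
  apply: contraNneq P0 => /colP v2E; apply/eqP/rowP => i; have := v2E i.
  by rewrite !mxE => /eqP; rewrite expf_eq0 => /andP[_ /eqP].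
have v10 : v1 != 0 by apply/eqP => v1E; apply: (v12 0); rewrite scale0r.
pose proof (projection_model pK q_pow q_gt1 P0 pA iotaP)
  as [u [f [s [h [sf f_irr fu _ [s1 h1 h0 uE rootE]]]]]].
have ef : exists x, root (map_poly iota f) x by exists u.
pose proof (norm f f_irr ef) as [rs rsE].
have urs : uniq rs.
  rewrite -separable_prod_XsubC -(eqp_separable rsE) separable_map.
  exact: sep f f_irr ef.
have srs : (2 < size rs)%N.
  have := eqp_size rsE; rewrite size_map_poly size_prod_XsubC sf => -[<-].
  by rewrite (leq_trans q_gt2) // leq_addr.
have rsroot r : (r \in rs) = root (map_poly iota f) r.
  by rewrite (eqp_root rsE) root_prod_XsubC.
have urs' : u \in rs by rewrite rsroot.
pose proof (two_other_mem urs srs urs') as [r2 [r3 [r2s r3s r23 r2u r3u]]].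
have l0 := hs_vec_form_neq0 v10.
have lineE r : r \in rs -> \val (r - u) * cl h * cl (vec_form v1) ^+ q
   + (\val (r - u) * cl h) ^+ q * cl (vec_form v2)
   + (\val (r - u) * cl h) ^+ q.+1 * cl al%:MP ^+ q = 0.
  rewrite rsroot => /(rootE r); rewrite /line_eq (conj_formE QP) pt_formE -alq.
  have -> : \val (r - u) * cl h = \val r * cl h - cl s.
    have -> : \val (r - u) = \val r - \val u by apply: rmorphB.
    by rewrite uE; apply: subf_div_mul h0.
  by rewrite !rmorphXn.
have hlE : \val (ff_frac X h (vec_form v1)) = cl h / cl (vec_form v1).
  exact: ff_fracE h1 (linear_form_homog _) l0.
have y0 r : r != u -> \val (r - u) != 0 by rewrite fmorph_eq0 subr_eq0.
have q0 : (0 < q)%N by apply: ltnW.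
have [NP|NP] := eqVneq (pt_norm q P) 0.
  apply: (@no_power_root _ _ _ _ _ pK q_pow q_gt2 n_gt0 d_neq0 P v1 v2
    ((r2 - u) * ff_frac X h (vec_form v1))) => //.
  (* l vanishes at [P], because the q-th power of its value there is F(P) = 0. *)
  - apply/rowP => j; rewrite ord1 !mxE; apply/eqP.
    have : (\sum_i P 0 i * Q 0 i) ^+ q == 0.
      rewrite (sum_expfDq _ pK q_pow) -[X in _ == X]NP; apply/eqP.
      by apply: eq_bigr => i _; rewrite exprMn QP exprSr.
    rewrite expf_eq0 => /andP[_ /eqP e0]; apply/eqP; rewrite -[RHS]e0.
    by apply: eq_bigr => i _; rewrite mxE.
  - apply/rowP => j; rewrite ord1 !mxE -[RHS]NP; apply: eq_bigr => i _.
    by rewrite mxE exprS.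
  have := lineE _ r2s; have -> : al = 0.
    by apply/eqP; move: NP; rewrite -alq => /eqP; rewrite expf_eq0 q0.
  rewrite mpolyC0 rmorph0 expr0n gtn_eqF // mulr0 addr0 => e2.
  have := power_of_root q0 l0 (mulf_neq0 (y0 _ r2u) h0) e2.
  have -> : \val ((r2 - u) * ff_frac X h (vec_form v1)) =
      \val (r2 - u) * \val (ff_frac X h (vec_form v1)) by apply: rmorphM.
  by rewrite hlE mulrA.
(* Now neither l nor b vanishes at [P], so the projection is replaced by one from a common zero,
   which exists as there are n + 2 > 2 coordinates. *)
have [P' P'0 P'v] := exists_left_kernel (row_mx v1 v2) (n_gt0 : (2 < n.+2)%N).
move: P'v; rewrite mul_mx_row => /eqP; rewrite row_mx_eq0 => /andP[/eqP P'1 /eqP P'2].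
have al0 : al != 0 by apply: contraNneq NP => al0; rewrite -alq al0 expr0n gtn_eqF.
have k0 : - (- al) ^+ q.-1 != 0 by rewrite oppr_eq0 expf_neq0 // oppr_eq0.
(* This is the element of [artin_schreier_of_roots], written inside the function field. *)
pose z : L := ((r2 - u)^-1 + ff_frac X al%:MP 1 * ff_frac X h (vec_form v1)) /
  ((r3 - u)^-1 - (r2 - u)^-1).
apply: (@no_artin_schreier_root _ _ _ _ _ pK q_pow q_gt2 n_gt0 d_neq0 P' v1 v2 z _
  P'0 P'1 P'2 v20 v12 k0).
have alE : \val (ff_frac X al%:MP 1) = cl al%:MP.
  rewrite (@ff_fracE _ _ _ 0) ?rmorph1 ?divr1 ?oner_neq0 ?dhomog1 //.
  by rewrite -[al%:MP]mulr1 mul_mpolyC; apply: rpredZ; apply: dhomog1.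
have zE : \val z = ((\val (r2 - u))^-1 + cl al%:MP * (cl h / cl (vec_form v1))) /
    ((\val (r3 - u))^-1 - (\val (r2 - u))^-1).
  by rewrite -alE -hlE; apply: (rmorph_slope \val).
have y23 : \val (r2 - u) != \val (r3 - u).
  by rewrite (inj_eq val_inj) (inj_eq (addIr _)).
have lin y : y = \val (r2 - u) \/ y = \val (r3 - u) ->
    y * cl h * cl (vec_form v1) ^+ q + (y * cl h) ^+ q * cl (vec_form v2)
     + (y * cl h) ^+ q.+1 * cl al%:MP ^+ q = 0.
  by case=> ->; apply: lineE.
pose proof (@artin_schreier_of_roots LL q _ (cl (vec_form v2)) (cl (vec_form v1))
  (cl al%:MP) (cl h) (\val (r2 - u)) (\val (r3 - u)) q0 (@expfDq_LL K p e q n pK q_pow n_gt0 d_neq0)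
  l0 h0 (y0 _ r2u) (y0 _ r3u) y23 erefl lin) as AS.
rewrite zE; apply: etrans AS _; congr (_ * _).
by rewrite !rmorphN !rmorphXn !rmorphN.
Qed.

(** The hypothesis makes P_i^q a q-th root of P_i, so l = b, and each m in [mus] gives the conjugate
    (s + m b) / h of [u]. These are as many as the degree of [f], which therefore splits. *)
Lemma self_conjugate_galois (P : 'rV[K]_n.+2) (mus : seq K) : P != 0 ->
  (forall i, P 0 i ^+ (q ^ 2) = P 0 i) -> uniq mus ->
  size mus = (q + (pt_norm q P != 0)) ->
  (forall m, m \in mus -> m + m ^+ q + m ^+ q.+1 * pt_norm q P = 0) ->
  galois_point X P.
Proof.
move=> P0 Pq umus smus musE.
have [A pA] := exists_projection P0.
pose proof (exists_coordinates P0 pA) as [c [B PAcB]].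
pose proof (exists_pullback pK q_pow q_gt1 n_gt0 d_neq0 P0 PAcB) as [iota iotaP].
exists A; first exact: pA.
exists iota; first exact: iotaP.
pose proof (projection_model pK q_pow q_gt1 P0 pA iotaP)
  as [u [f [s [h [sf f_irr fu gen [s1 h1 h0 uE rootE]]]]]].
have b0 : cl (pt_form q P) != 0.
  rewrite pt_formE; apply: hs_vec_form_neq0; apply: contraNneq P0 => /colP PE.
  apply/eqP/rowP => i; have := PE i.
  by rewrite !mxE => /eqP; rewrite expf_eq0 => /andP[_ /eqP].
have b1 : pt_form q P \is 1.-homog by apply: linear_form_homog.
have cE : conj_form q P = pt_form q P ^+ q.
  rewrite (@conj_formE P (\row_i P 0 i ^+ q)) => [|i]; last first.
    by rewrite mxE -exprM mulnn Pq.
  by rewrite pt_formE; congr (linear_form _ ^+ q); apply/funext => i; rewrite !mxE.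
pose t m : L := ff_frac X (s + m *: pt_form q P) h.
have tE m : \val (t m) = (cl s + cl m%:MP * cl (pt_form q P)) / cl h.
  have hom : s + m *: pt_form q P \is 1.-homog by rewrite rpredD ?rpredZ.
  have -> : \val (t m) = cl (s + m *: pt_form q P) / cl h := ff_fracE hom h1 h0.
  by rewrite rmorphD -mul_mpolyC rmorphM.
have tI : injective t.
  move=> m m' /(congr1 \val); rewrite !tE => /(mulIf (invr_neq0 h0))/addrI/(mulIf b0).
  exact: hs_const_inj.
apply: (galois_simple_ext f_irr fu gen (rs := [seq t m | m <- mus])).
- by rewrite map_inj_uniq.
- apply/allP => _ /mapP[m mm ->]; apply/(rootE (t m)).
  have -> : \val (t m) * cl h - cl s = cl m%:MP * cl (pt_form q P).
    by rewrite tE; apply: divf_mul_sub h0.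
  have me : cl m%:MP + cl m%:MP ^+ q + cl m%:MP ^+ q.+1 * cl (pt_norm q P)%:MP = 0.
    have /(congr1 (fun x => cl x%:MP)) := musE m mm.
    by rewrite !rmorphD !rmorphM !rmorphXn !rmorph0.
  by rewrite /line_eq cE rmorphXn; apply: line_term_root.
- by rewrite size_map smus sf.
Qed.

End Rationality.

Lemma closed_root (K : closedFieldType) m (x : K) : (0 < m)%N -> exists y, y ^+ m = x.
Proof.
move=> m0; have [|y] := closed_rootP ('X^m - x%:P) _.
  by rewrite size_XnsubC // eqSS -lt0n.
by move/rootP/eqP; rewrite hornerD hornerN hornerXn hornerC subr_eq0 => /eqP; exists y.
Qed.

Lemma galois_point_scale (K : fieldType) n (X : hypersurface K n.+1) (P : 'rV[K]_n.+2) c :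
  c != 0 -> galois_point X (c *: P) -> galois_point X P.
Proof.
move=> c0 [A [PA rA] gal]; exists A => //; split=> //.
by move/eqP: PA; rewrite -scalemxAl scaler_eq0 (negPf c0) => /eqP.
Qed.

(** Dependence gives P_i = a^q P_i^(q^2). Rescaling by c with c^(q^2 - 1) = a^q absorbs the
    factor. *)
Lemma rational_of_dependent (K : closedFieldType) n q (P Q : 'rV[K]_n.+2) (a : K) :
  (1 < q)%N -> P != 0 -> (forall i, Q 0 i ^+ q = P 0 i) ->
  (\col_i Q 0 i) = a *: (\col_i P 0 i ^+ q) -> rational_point (q ^ 2) P.
Proof.
move=> q1 P0 QP QE.
have QPi i : Q 0 i = a * P 0 i ^+ q.
  by have /colP/(_ i) := QE; rewrite !mxE.
have PE i : P 0 i = a ^+ q * P 0 i ^+ (q ^ 2).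
  by rewrite -{1}QP QPi exprMn -exprM mulnn.
have q20 : (0 < q ^ 2)%N by rewrite expn_gt0 ltnW.
have a0 : a != 0.
  apply: contraNneq P0 => a0; apply/eqP/rowP => i.
  by rewrite PE a0 expr0n (gtn_eqF (ltnW q1)) mul0r mxE.
have [|c cE] := @closed_root K (q ^ 2).-1 (a ^+ q).
  by rewrite -subn1 subn_gt0 -(exp1n 2) ltn_exp2r.
have c0 : c != 0.
  apply: contraTneq (expf_neq0 q a0) => c0; rewrite -cE c0 expr0n gtn_eqF ?eqxx //.
  by rewrite -subn1 subn_gt0 -(exp1n 2) ltn_exp2r.
exists c => // i; rewrite exprMn -{1}(prednK q20) exprS cE -mulrA; congr (_ * _).
by rewrite -PE.
Qed.

(** The polynomial a X^(q+1) + X^q + X has derivative a X^q + 1. At a common root m, a m^q = -1 and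
    the polynomial takes the value m^q, so m^q = 0, a contradiction; hence all roots are simple. *)
Lemma unipotent_roots (K : closedFieldType) p e q (a : K) : p \in [pchar K] ->
  q = (p ^ e)%N -> (1 < q)%N ->
  exists mus : seq K, [/\ uniq mus, size mus = (q + (a != 0))
    & forall m, m \in mus -> m + m ^+ q + m ^+ q.+1 * a = 0].
Proof.
move=> pK qE q1.
pose f : {poly K} := a *: 'X^(q.+1) + ('X^q + 'X).
have szX : size ('X^q + 'X : {poly K}) = q.+1.
  by rewrite size_polyDl size_polyXn // size_polyX ltnS.
have szf : size f = (q + (a != 0)).+1.
  rewrite /f; have [->|a0] := eqVneq a 0; first by rewrite scale0r add0r szX addn0.
  by rewrite size_polyDl size_scale // size_polyXn ?szX // addn1.
have q0 : (q%:R : K) = 0.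
  rewrite qE natrX (pcharf0 pK) expr0n; case: e qE q1 => // ->.
  by rewrite expn0.
have fev m : f.[m] = m + m ^+ q + m ^+ q.+1 * a.
  by rewrite /f hornerD hornerZ hornerD !hornerXn hornerX; ring.
have df m : f^`().[m] = a * m ^+ q + 1.
  have Mq (x : K) : x *+ q = 0 by rewrite -mulr_natr q0 mulr0.
  rewrite /f derivD derivZ derivD derivX !derivXn hornerD hornerZ hornerD hornerC.
  by rewrite !hornerMn !hornerXn Mq add0r mulrSr Mq add0r.
have [rs rsE] := closed_field_poly_normal f.
have f0 : f != 0 by rewrite -size_poly_gt0 szf.
have l0 : lead_coef f != 0 by rewrite lead_coef_eq0.
exists rs; split.
- have fE : f %= \prod_(r <- rs) ('X - r%:P) by rewrite {1}rsE eqp_scale.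
  rewrite -separable_prod_XsubC -(eqp_separable fE).
  rewrite unlock; apply: Pdiv.ClosedField.root_coprimep => m /rootP fm; rewrite df.
  apply: contra_eq_neq fm => am; have am1 : a * m ^+ q = -1 by apply/eqP; rewrite -addr_eq0 am.
  have -> : f.[m] = m ^+ q.
    by rewrite fev exprSr mulrAC -[m ^+ q * a]mulrC am1; ring.
  apply/eqP => mq; move/eqP: am1.
  by rewrite mq mulr0 eq_sym oppr_eq0 oner_eq0.
- have := szf; rewrite rsE size_scale // size_prod_XsubC => -[].
  by [].
- by move=> m mrs; rewrite -fev; apply/rootP; rewrite rsE rootZ // root_prod_XsubC.
Qed.

Theorem theorem5 (K : closedFieldType) (p e q n : nat)
    (pK : p \in [pchar K]) (q_pow : q = (p ^ e)%N) (q_ge3 : (3 <= q)%N)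
    (n_gt0 : (1 <= n)%N) (P : 'rV[K]_n.+2) (P_neq0 : P != 0) :
  galois_point (fermat_hypersurface n_gt0 (natrS_neq0 pK q_pow q_ge3)) P <->
  rational_point (q ^ 2) P.
Proof.
have q1 : (1 < q)%N := ltnW q_ge3.
split=> [gal|[c c0 cP]].
  have [Q QP] : exists Q : 'rV[K]_n.+2, forall i, Q 0 i ^+ q = P 0 i.
    have H i : exists y, y ^+ q = P 0 i by apply: closed_root; apply: ltnW.
    by exists (\row_i projT1 (cid (H i))) => i; rewrite mxE; case: cid.
  have [al alq] := closed_root (pt_norm q P) (ltnW q1).
  have [a QE] := galois_dependent pK q_pow q_ge3 P_neq0 QP alq gal.
  exact: rational_of_dependent q1 P_neq0 QP QE.
(* Scaling by [c] gives coordinates fixed by the q^2-th power map, as [self_conjugate_galois]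
   requires. *)
apply: (galois_point_scale c0).
have [mus [umus smus musE]] := unipotent_roots (pt_norm q (c *: P)) pK q_pow q1.
have cP0 : c *: P != 0 by rewrite scaler_eq0 negb_or c0.
have cPq i : (c *: P) 0 i ^+ (q ^ 2) = (c *: P) 0 i by rewrite mxE cP.
refine (self_conjugate_galois pK q_pow q_ge3 _ _ cP0 cPq umus smus musE).
Qed.
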